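(* Let $Y$ be a paracompact space, on which a group $G$ acts by homeomorphisms. Let $I$ be a set equipped with a left $G$-action, and let $\mathcal U=\{Y_i\}_{i\in I}$ be an open covering of $Y$ with the following properties: - $gY_i=Y_{gi}$ for all $g\in G$ and $i\in I$; - for any finite $F\subset I$, the intersection $\bigcap_{i\in F}Y_i$ is either empty or contractible. Let $\mathcal N$ be the nerve of the covering $\mathcal U$. Then $G$ acts on $\mathcal N$ by simplicial automorphisms, and there is a $G\!\sim$ homotopy equivalence $f\colon Y\to(\mathcal N,\mathcal T_m)$. Consequently, there is also a $G\!\sim$ homotopy equivalence $Y\to(\mathcal N,\mathcal T_w)$.
   Context: If a group $G$ acts by homeomorphisms on topological spaces $A,B$, a map $f\colon A\to B$ is a $G\!\sim$ homotopy equivalence if it is a homotopy equivalence and, for every $g\in G$, the maps $g\circ f$ and $f\circ g$ are homotopic. The nerve $\mathcal N$ of a covering $\{Y_i\}_{i\in I}$ is the simplicial complex with a vertex $v_i$ for each (nonempty) $Y_i$, and with an $n$-simplex spanned by $v_{i_0},\dots,v_{i_n}$ whenever $\bigcap_{j=0}^n Y_{i_j}\neq\emptyset$. Finite subsets $F$ in the hypothesis are nonempty. $\mathcal T_w$ is the weak topology on $\mathcal N$: a set is closed if and only if its intersection with each closed simplex is closed. $\mathcal T_m$ is the metric topology: the subspace topology from the embedding of $\mathcal N$ into the real vector space of finitely supported functions $\mathcal N^{(0)}\to\mathbb R$ with the $\ell^2$ norm, sending each vertex to its Dirac function and extending affinely over simplices. *)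

(* Defs.v *)
From HB Require Import structures.
From mathcomp Require Import all_boot all_order all_algebra finmap.
From mathcomp Require Import all_classical all_reals all_analysis.
From mathcomp Require Import ring.

Set Implicit Arguments.
Unset Strict Implicit.
Unset Printing Implicit Defensive.
Import Order.TTheory GRing.Theory Num.Theory.
Import numFieldNormedType.Exports.
Local Open Scope classical_set_scope.
Local Open Scope ring_scope.

Definition locally_finite (Y : topologicalType) (D : set (set Y)) : Prop :=
  forall y : Y, exists2 W : set Y,
    nbhs y W & finite_set [set V | D V /\ V `&` W !=set0].

Definition open_cover (Y : topologicalType) (C : set (set Y)) : Prop :=
  (forall V, C V -> open V) /\ \bigcup_(V in C) V = setT.

Definition refines (Y : Type) (D C : set (set Y)) : Prop :=
  forall V, D V -> exists2 W, C W & V `<=` W.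

(* Hausdorff is part of the definition, so that partitions of unity exist *)
Definition paracompact (Y : topologicalType) : Prop :=
  hausdorff_space Y /\
  forall C : set (set Y), open_cover C ->
    exists D : set (set Y), [/\ open_cover D, refines D C & locally_finite D].

Definition homotopic (R : realType) (A B : topologicalType) (f g : A -> B) :
    Prop :=
  exists H : A * R -> B,
    [/\ {within [set: A] `*` `[0, 1], continuous H},
        forall x, H (x, 0) = f x & forall x, H (x, 1) = g x].

Definition homotopy_equivalence (R : realType) (A B : topologicalType)
    (f : A -> B) : Prop :=
  continuous f /\
  exists h : B -> A, [/\ continuous h, homotopic R (h \o f) idfun
                       & homotopic R (f \o h) idfun].

Definition contractible (R : realType) (A : topologicalType) : Prop :=
  exists p : A, homotopic R (@idfun A) (cst p).

Definition is_action (G : groupType) (T : Type) (act : G -> T -> T) : Prop :=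
  (forall x, act 1%g x = x) /\
  (forall g h x, act (g * h)%g x = act g (act h x)).

Definition homeomorphism (A B : topologicalType) (f : A -> B) : Prop :=
  continuous f /\
  exists h : B -> A, [/\ continuous h, cancel f h & cancel h f].

Definition is_homeo_action (G : groupType) (T : topologicalType)
    (act : G -> T -> T) : Prop :=
  is_action act /\ forall g, homeomorphism (act g).

Definition Gsim_homotopy_equivalence (R : realType) (G : groupType)
    (A B : topologicalType) (actA : G -> A -> A) (actB : G -> B -> B)
    (f : A -> B) : Prop :=
  [/\ is_homeo_action actA, is_homeo_action actB, homotopy_equivalence R f
    & forall g, homotopic R (actB g \o f) (f \o actA g)].

Record simplicial_complex := SimplicialComplex {
  vertex :> choiceType;
  simplex : set {fset vertex};
  simplex_neq0 : forall s, simplex s -> s != fset0;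
  simplex_sub : forall s t : {fset vertex},
    simplex s -> (t `<=` s)%fset -> t != fset0 -> simplex t;
  simplex1 : forall v : vertex, simplex [fset v]%fset }.

Record simplicial_map (K L : simplicial_complex) := SimplicialMap {
  smap :> K -> L;
  smapP : forall s : {fset K}, simplex s -> simplex [fset smap v | v in s]%fset }.

Definition simplicial_automorphism (K : simplicial_complex)
    (phi : simplicial_map K K) : Prop :=
  exists psi : simplicial_map K K, cancel phi psi /\ cancel psi phi.

Section nerve.
Context {Y : Type} {I : choiceType} (U : I -> set Y).

(* Vertices are indices: [U i = U j] with [i != j] gives two vertices *)
Definition nerve_vertex : choiceType := set_type [set i | U i !=set0].

Definition nerve_simplex : set {fset nerve_vertex} :=
  [set s | s != fset0 /\ \bigcap_(v in [set` s]) U (val v) !=set0].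

Lemma nerve_simplex_neq0 s : nerve_simplex s -> s != fset0.
Proof. by case. Qed.

Lemma nerve_simplex_sub (s t : {fset nerve_vertex}) :
  nerve_simplex s -> (t `<=` s)%fset -> t != fset0 -> nerve_simplex t.
Proof.
move=> [_ [y sy]] /fsubsetP ts t0; split => //.
by exists y => v /= vt; apply: sy => /=; exact: ts.
Qed.

Lemma nerve_simplex1 (v : nerve_vertex) : nerve_simplex [fset v]%fset.
Proof.
split; first by apply/fset0Pn; exists v; rewrite inE.
have [y Uy] : U (val v) !=set0 by have := set_valP v.
by exists y => w /=; rewrite inE => /eqP ->.
Qed.

Definition nerve : simplicial_complex :=
  SimplicialComplex nerve_simplex_neq0 nerve_simplex_sub nerve_simplex1.

End nerve.

(* Finitely supported functions, with the metric of the l2 norm *)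
Definition fin_l2 (R : realType) (V : choiceType) : Type :=
  {fsfun V -> R with 0}.

Section fin_l2.
Context {R : realType} {V : choiceType}.
Implicit Types x y z : {fsfun V -> R with 0}.

HB.instance Definition _ := Choice.on (fin_l2 R V).

Definition l2dist (x y : fin_l2 R V) : R :=
  Num.sqrt (\sum_(v <- (finsupp x `|` finsupp y)%fset) (x v - y v) ^+ 2).

Lemma l2dist_widen x y (S : {fset V}) :
  (finsupp x `|` finsupp y `<=` S)%fset ->
  l2dist x y = Num.sqrt (\sum_(v <- S) (x v - y v) ^+ 2).
Proof.
move=> sub; rewrite /l2dist; congr Num.sqrt.
apply: big_fset_incl => // v _; rewrite inE negb_or => /andP[vx vy].
by rewrite !fsfun_dflt// subrr expr0n.
Qed.

Lemma l2dist_xx x : l2dist x x = 0.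
Proof. by rewrite /l2dist big1 ?sqrtr0// => v _; rewrite subrr expr0n. Qed.

Lemma l2dist_positivity x y : l2dist x y = 0 -> x = y.
Proof.
move=> /eqP; rewrite sqrtr_eq0 => le0; apply/fsfunP => v.
have [vS|] := boolP (v \in (finsupp x `|` finsupp y)%fset); last first.
  by rewrite inE negb_or => /andP[vx vy]; rewrite !fsfun_dflt.
apply/eqP; rewrite -subr_eq0 -sqrf_eq0 eq_le sqr_ge0 andbT.
apply: le_trans le0; rewrite (big_fsetD1 v)//= lerDl.
by apply: sumr_ge0 => w _; exact: sqr_ge0.
Qed.

Lemma l2dist_sym x y : l2dist x y = l2dist y x.
Proof.
rewrite /l2dist fsetUC; congr Num.sqrt; apply: eq_bigr => v _.
by rewrite -sqrrN opprB.
Qed.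

Lemma sum_cauchy_schwarz (s : seq V) (a b : V -> R) :
  (\sum_(v <- s) a v * b v) ^+ 2 <=
  (\sum_(v <- s) a v ^+ 2) * (\sum_(v <- s) b v ^+ 2).
Proof.
set C := \sum_(v <- s) _; set A := \sum_(v <- s) _; set B := \sum_(v <- s) _.
have B0 : 0 <= B by apply: sumr_ge0 => v _; exact: sqr_ge0.
have key t u : 0 <= t ^+ 2 * A - t * u * 2 * C + u ^+ 2 * B.
  rewrite /A /B /C !mulr_sumr -sumrB -big_split/=.
  apply: sumr_ge0 => v _.
  have -> : t ^+ 2 * a v ^+ 2 - t * u * 2 * (a v * b v) + u ^+ 2 * b v ^+ 2 =
    (t * a v - u * b v) ^+ 2 by rewrite sqrrB !exprMn; ring.
  exact: sqr_ge0.
move: B0; rewrite le_eqVlt => /orP[/eqP B0|B0].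
  rewrite -B0 mulr0; rewrite leNgt; apply/negP => C0.
  have := key 1 ((A + 1) / (2 * C)); rewrite -B0.
  have Cn0 : C != 0 by rewrite -sqrf_eq0 gt_eqF.
  have -> : 1 ^+ 2 * A - 1 * ((A + 1) / (2 * C)) * 2 * C +
    ((A + 1) / (2 * C)) ^+ 2 * 0 = -1 by field; rewrite Cn0.
  by rewrite lerNr oppr0 ler10.
have := key B C.
have -> : B ^+ 2 * A - B * C * 2 * C + C ^+ 2 * B = B * (A * B - C ^+ 2) by ring.
by rewrite pmulr_rge0// subr_ge0.
Qed.

Lemma l2dist_triangle y x z : l2dist x z <= l2dist x y + l2dist y z.
Proof.
pose S := (finsupp x `|` finsupp y `|` finsupp z)%fset.
have xz : (finsupp x `|` finsupp z `<=` S)%fset.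
  by apply: fsetSU; exact: fsubsetUl.
have xy : (finsupp x `|` finsupp y `<=` S)%fset by exact: fsubsetUl.
have yz : (finsupp y `|` finsupp z `<=` S)%fset.
  by apply: fsetSU; exact: fsubsetUr.
rewrite (l2dist_widen xz) (l2dist_widen xy) (l2dist_widen yz).
pose a v := x v - y v; pose b v := y v - z v.
set A := \sum_(v <- S) (x v - y v) ^+ 2; set B := \sum_(v <- S) (y v - z v) ^+ 2.
have A0 : 0 <= A by apply: sumr_ge0 => v _; exact: sqr_ge0.
have B0 : 0 <= B by apply: sumr_ge0 => v _; exact: sqr_ge0.
pose C := \sum_(v <- S) a v * b v.
have -> : \sum_(v <- S) (x v - z v) ^+ 2 = A + 2 * C + B.
  rewrite /A /B /C mulr_sumr -!big_split/=; apply: eq_bigr => v _.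
  by rewrite /a /b; ring.
have CAB : C <= Num.sqrt A * Num.sqrt B.
  rewrite -sqrtrM//; apply: le_trans (ler_norm _) _.
  by rewrite -sqrtr_sqr; apply: ler_wsqrtr; exact: sum_cauchy_schwarz.
rewrite -[leRHS]ger0_norm ?addr_ge0 ?sqrtr_ge0// -sqrtr_sqr.
apply: ler_wsqrtr; rewrite sqrrD !sqr_sqrtr// lerD2r lerD2l.
by rewrite -[leRHS]mulr_natl ler_wpM2l.
Qed.

HB.instance Definition _ := @isMetric.Build R (fin_l2 R V) l2dist
  l2dist_xx l2dist_positivity l2dist_sym l2dist_triangle.

End fin_l2.

(* A point of the realization is given by its barycentric coordinates, i.e. by
   its image under the affine embedding sending each vertex to its Dirac
   function *)
Definition barycentric (R : realType) (K : simplicial_complex) :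
    set (fin_l2 R K) :=
  [set x | [/\ simplex (finsupp x), forall v, 0 <= x v
             & \sum_(v <- finsupp x) x v = 1]].

(* The canonical topology of [metric_realization] is the subspace topology
   induced by [fin_l2 R K] *)
Definition metric_realization (R : realType) (K : simplicial_complex) : Type :=
  set_type (@barycentric R K).

HB.instance Definition _ (R : realType) (K : simplicial_complex) :=
  PseudoMetric.on (metric_realization R K).

Definition closed_simplex (R : realType) (K : simplicial_complex)
    (s : {fset K}) : set (metric_realization R K) :=
  [set x | (finsupp (val x) `<=` s)%fset].
Arguments closed_simplex R {K} s.

Definition weak_realization (R : realType) (K : simplicial_complex) : Type :=
  metric_realization R K.

Section weak_topology.
Context {R : realType} {K : simplicial_complex}.

HB.instance Definition _ := Choice.on (weak_realization R K).

(* Each closed simplex carries its Euclidean topology, which is the one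
   induced by the l2 distance; see [closed_weakE] for closed sets *)
Definition weak_open (A : set (weak_realization R K)) : Prop :=
  forall s : {fset K}, simplex s ->
    open (A : set (subspace (closed_simplex R s))).

Let weak_openT : weak_open setT.
Proof. by move=> s _; exact: openT. Qed.

Let weak_openI (A B : set (weak_realization R K)) :
  weak_open A -> weak_open B -> weak_open (A `&` B).
Proof. by move=> oA oB s sK; apply: openI; [exact: oA|exact: oB]. Qed.

Let weak_open_bigU (J : Type) (f : J -> set (weak_realization R K)) :
  (forall j, weak_open (f j)) -> weak_open (\bigcup_j f j).
Proof. by move=> of_ s sK; apply: bigcup_open => j _; exact: of_. Qed.

HB.instance Definition _ := isOpenTopological.Build (weak_realization R K)
  weak_openT weak_openI weak_open_bigU.

Lemma open_weakE (A : set (weak_realization R K)) : open A = weak_open A.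
Proof. by []. Qed.

Lemma closed_weakE (A : set (weak_realization R K)) :
  closed A <-> forall s : {fset K}, simplex s ->
    closed (A `&` closed_simplex R s : set (subspace (closed_simplex R s))).
Proof.
rewrite -openC open_weakE; split=> H s sK.
  by rewrite -openC -open_subspaceIT setCI setIUl setICl setU0
    open_subspaceIT; exact: H.
have := H s sK; rewrite -openC -open_subspaceIT setCI setIUl setICl setU0.
by rewrite open_subspaceIT.
Qed.

End weak_topology.

Section realize.
Context {R : realType} {K L : simplicial_complex} (phi : simplicial_map K L).

(* Affine extension of [phi]: \sum_v x_v v is sent to \sum_v x_v (phi v) *)
Definition push (x : fin_l2 R K) : fin_l2 R L :=
  [fsfun w in [fset phi v | v in finsupp x]%fset =>
    \sum_(v <- finsupp x | phi v == w) x v].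

Lemma push_barycentric x : barycentric x -> barycentric (push x).
Proof.
move=> [xK x_ge0 x1].
have pushE w : push x w = \sum_(v <- finsupp x | phi v == w) x v.
  rewrite /push fsfunE; case: ifPn => // wx; rewrite big_seq_cond big1// => v.
  by move=> /andP[vx /eqP vw]; move: wx; rewrite -vw in_imfset.
have supp_push : finsupp (push x) = [fset phi v | v in finsupp x]%fset.
  apply/eqP; rewrite eqEfsubset; apply/andP; split; apply/fsubsetP => w.
    by rewrite mem_finsupp /push fsfunE; case: ifPn => //; rewrite eqxx.
  move=> /imfsetP[/= v vx ->]; rewrite mem_finsupp pushE gt_eqF//.
  rewrite big_mkcond (big_fsetD1 v)//= eqxx ltr_pwDl//; last first.
    by apply: sumr_ge0 => u _; case: ifP.
  by rewrite lt_neqAle x_ge0 andbT eq_sym -mem_finsupp.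
split; first by rewrite supp_push; exact: smapP.
  by move=> w; rewrite pushE; exact: sumr_ge0.
rewrite supp_push -x1; under eq_bigr do rewrite pushE.
rewrite (exchange_big_dep xpredT)//= big_seq [RHS]big_seq; apply: eq_bigr => v vx.
rewrite big_mkcond (big_fsetD1 (phi v)) ?in_imfset//= eqxx big_seq big1 ?addr0//.
by move=> w; rewrite !inE eq_sym => /andP[/negPf ->].
Qed.

Definition realize (x : metric_realization R K) : metric_realization R L :=
  SigSub (mem_set (push_barycentric (set_valP x))).

End realize.

(* Main.v *)
(* A locally finite partition of unity subordinate to the cover gives
   f : Y -> N.  For the inverse g : N -> Y, choose a contraction of every
   nonempty finite intersection U_s.  The superlevel sets of the barycentric
   coordinates of x form a chain of simplices s_1 > ... > s_n; start at a point
   of the smallest intersection U_(s_1) and run successively the contractions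
   of U_(s_1), U_(s_2), ..., each for a time proportional to the gap between the
   levels where the superlevel set is s_i.  A set occurring for time zero is
   skipped, which makes the result continuous in x; rescaling the levels makes
   some contraction run to its end, so that the starting point is irrelevant.
   Starting at y itself and scaling the times by t in [0, 1] gives a homotopy
   from the identity of Y to g o f.  Only levels between 1/2 and 3/4 of the
   squared l2 norm of x, which the largest coordinate bounds, are used: this
   makes the construction locally finite for the metric topology, and puts g x
   in U_v as soon as the coordinate x_v exceeds the upper threshold.  All other homotopies
   are affine, inside simplices of N. *)
Require Import Defs.
From HB Require Import structures.
From mathcomp Require Import all_boot all_order all_algebra finmap.
From mathcomp Require Import all_classical all_reals all_analysis.
From mathcomp Require Import ring lra.

Set Implicit Arguments.
Unset Strict Implicit.
Unset Printing Implicit Defensive.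
Import Order.TTheory GRing.Theory Num.Theory.
Import numFieldNormedType.Exports.
Local Open Scope classical_set_scope.
Local Open Scope ring_scope.

(** * Barycentric coordinates and the metric topology *)

(* HB does not find these through the aliases of [set_type]. *)
#[local] Instance nbhs_realization_filter (R : realType)
  (K : simplicial_complex) (x : metric_realization R K) :
  ProperFilter (nbhs x) := nbhs_pfilter x.

#[local] Instance nbhs_weak_realization_filter (R : realType)
  (K : simplicial_complex) (x : weak_realization R K) :
  ProperFilter (nbhs x) := nbhs_pfilter x.

Section realization_topology.
Context {R : realType} {K : simplicial_complex}.
Local Notation N := (metric_realization R K).

Definition bary (x : N) (v : K) : R := (val x : fin_l2 R K) v.
Definition supp (x : N) : {fset K} := finsupp (val x : fin_l2 R K).

Lemma in_supp x v : (v \in supp x) = (bary x v != 0).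
Proof. by rewrite mem_finsupp. Qed.

Lemma supp_simplex x : simplex (supp x).
Proof. by have [] := set_valP x. Qed.

Lemma bary_ge0 x v : 0 <= bary x v.
Proof. by have [_ + _] := set_valP x; exact. Qed.

Lemma bary_gt0 x v : (0 < bary x v) = (v \in supp x).
Proof. by rewrite in_supp lt_neqAle bary_ge0 andbT eq_sym. Qed.

Lemma sum_bary x : \sum_(v <- supp x) bary x v = 1.
Proof. by have [] := set_valP x. Qed.

Lemma sum_bary_widen x (S : {fset K}) : (supp x `<=` S)%fset ->
  \sum_(v <- S) bary x v = 1.
Proof.
move=> xS; rewrite -(sum_bary x); symmetry.
by apply: big_fset_incl => // v _; rewrite in_supp negbK => /eqP.
Qed.

Lemma sum_bary_le1 x (S : {fset K}) : \sum_(v <- S) bary x v <= 1.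
Proof.
rewrite -(sum_bary_widen (fsubsetUr S (supp x))).
rewrite [leRHS](big_fsetID _ (mem S))/=.
rewrite [X in _ <= X + _](_ : _ = \sum_(v <- S) bary x v).
  by rewrite lerDl; apply: sumr_ge0 => v _; exact: bary_ge0.
by apply: eq_fbigl => v; rewrite !inE/= andb_orl andbb orb_idr// => /andP[].
Qed.

Lemma bary_le1 x v : bary x v <= 1.
Proof. by have := sum_bary_le1 x [fset v]%fset; rewrite big_seq_fset1. Qed.

Lemma realization_eq (x y : N) : bary x =1 bary y -> x = y.
Proof. by move=> xy; apply/val_inj/fsfunP => v; exact: xy. Qed.

Lemma nbhs_realizationP (x : N) (A : set N) :
  nbhs x A <-> exists2 e : R, 0 < e & forall y : N,
    l2dist (val x) (val y) < e -> A y.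
Proof. by split => [/nbhs_ballP|exA]; [|apply/nbhs_ballP]. Qed.

Lemma ler_bary_dist (x y : N) v : `|bary x v - bary y v| <= l2dist (val x)
  (val y).
Proof.
rewrite -sqrtr_sqr.
rewrite (@l2dist_widen _ _ _ _ (v |` (supp x `|` supp y))%fset);
  last exact: fsubsetUr.
apply: ler_wsqrtr; rewrite (big_fsetD1 v) ?fset1U1//= lerDl.
by apply: sumr_ge0 => w _; exact: sqr_ge0.
Qed.

Lemma continuous_bary v : continuous (bary ^~ v).
Proof.
move=> x; apply/cvgrPdist_lt => e e0; apply/nbhs_realizationP; exists e => // y.
exact: le_lt_trans (ler_bary_dist _ _ _).
Qed.

Lemma continuous_bary_comp (Z : topologicalType) (a : Z -> N) (z : Z) v :
  {for z, continuous a} -> {for z, continuous (fun y => bary (a y) v)}.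
Proof.
move=> az; apply: (@continuous_comp _ _ _ a (bary ^~ v)) => //.
exact: continuous_bary.
Qed.

Lemma near_seq (Z : Type) (F : set_system Z) {FF : Filter F} (J : eqType)
    (s : seq J) (P : J -> Z -> Prop) :
  (forall j, j \in s -> \forall z \near F, P j z) ->
  \forall z \near F, forall j, j \in s -> P j z.
Proof.
elim: s => [|i s IH] sP; first by apply: nearW => z j.
have Pi := sP i (mem_head _ _).
have Ps : \forall z \near F, forall j, j \in s -> P j z.
  by apply: IH => j js; apply: sP; rewrite inE js orbT.
near=> z => j; rewrite inE => /orP[/eqP ->|]; first by near: z.
by move: j; near: z.
Unshelve. all: by end_near. Qed.

Lemma near_fset (Z : Type) (F : set_system Z) {FF : Filter F} (J : choiceType)
    (s : {fset J}) (P : J -> Z -> Prop) :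
  (forall j, j \in s -> \forall z \near F, P j z) ->
  \forall z \near F, forall j, j \in s -> P j z.
Proof. exact: near_seq. Qed.

(* Coordinates sum to 1, so closeness on [supp x] bounds the mass outside it. *)
Lemma sqr_l2dist_le (x y : N) (d : R) : d <= 1 ->
  (forall v, v \in supp x -> `|bary x v - bary y v| < d) ->
  l2dist (val x) (val y) ^+ 2 <= 2 * d *+ #|` supp x|.
Proof.
move=> d1 xyd; rewrite /l2dist sqr_sqrtr; last first.
  by apply: sumr_ge0 => v _; exact: sqr_ge0.
set T := (_ `|` _)%fset.
have -> : 2 * d *+ #|` supp x| = \sum_(v <- T) (if v \in supp x then 2 * d
  else 0).
  rewrite -(@big_fset_incl _ _ _ _ (supp x) T)//=; last 2 first.
  - exact: fsubsetUl.
  - by move=> v _ /negPf ->.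
  rewrite (eq_big_seq (fun=> 2 * d)) => [|v ->//].
  by rewrite big_const_seq count_predT iter_addr_0.
(* Adding this zero sum makes the bound hold term by term: off [supp x] the square [bary y v ^+ 2]
   is at most [bary y v]; on [supp x] both [(a - b) ^+ 2] and [a - b] are at most [d]. *)
have E0 : \sum_(v <- T) (bary y v - bary x v) = 0.
  by rewrite sumrB !sum_bary_widen ?subrr// ?fsubsetUl// fsubsetUr.
rewrite -[leRHS]add0r -[X in X + _]E0 -big_split/=; apply: ler_sum => v _.
case: ifPn => [vx|]; last first.
  rewrite in_supp negbK => /eqP xv.
  rewrite -/(bary x v) -/(bary y v) xv !sub0r sqrrN subr0 addr0 expr2.
  by rewrite ler_piMr ?bary_ge0 ?bary_le1.
rewrite -/(bary x v) -/(bary y v).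
have := xyd v vx; rewrite ltr_norml => /andP[].
set a := bary x v; set b := bary y v => da ad.
rewrite -lerBlDl -[(a - b) ^+ 2]real_normK ?num_real//.
have : `|a - b| ^+ 2 <= d.
  have abd : `|a - b| < d by rewrite ltr_norml da ad.
  rewrite expr2; apply: le_trans (ltW abd); rewrite ler_piMl//.
  exact: le_trans (ltW abd) d1.
by move: (`|a - b| ^+ 2) => c; lra.
Qed.

(** The finitely many coordinates in [supp x] already control the distance to [x], by
    [sqr_l2dist_le]. *)
Lemma cvg_realizationP (Z : Type) (F : set_system Z) {FF : Filter F}
    (a : Z -> N) (x : N) :
  (forall v, bary (a z) v @[z --> F] --> bary x v) -> a z @[z --> F] --> x.
Proof.
move=> avx; apply/cvg_ballP => e e0.
(* The successor makes the bound of [sqr_l2dist_le] strictly smaller than [e ^+ 2]. *)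
pose d := Num.min 1 (e ^+ 2 / (2 * #|` supp x|.+1)%:R).
have d0 : 0 < d by rewrite lt_min ltr01 divr_gt0 ?exprn_gt0 ?ltr0n.
have : \forall z \near F, forall v, v \in supp x ->
  `|bary x v - bary (a z) v| < d.
  by apply: near_fset => v _; move/cvgrPdist_lt: (avx v); apply.
apply: filterS => z xz; change (l2dist (val x) (val (a z)) < e).
rewrite -(@ltr_pXn2r _ 2) ?nnegrE ?sqrtr_ge0 ?(ltW e0)//.
apply: le_lt_trans (sqr_l2dist_le _ xz) _; first by rewrite ge_min lexx.
have : d <= e ^+ 2 / (2 * #|` supp x|.+1)%:R by rewrite ge_min lexx orbT.
rewrite ler_pdivlMr ?ltr0n// => h; apply: lt_le_trans h.
by rewrite -mulr_natr natrM mulrA [d * 2]mulrC ltr_pM2l ?mulr_gt0 ?ltr0n//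
  ltr_nat.
Qed.

Lemma continuous_realization (Z : topologicalType) (a : Z -> N) (z : Z) :
  (forall v, {for z, continuous (fun z => bary (a z) v)}) -> {for z,
    continuous a}.
Proof. by move=> av; apply: cvg_realizationP => v; exact: av. Qed.

End realization_topology.

(** * The weak topology *)

Lemma continuous_near_eq (Z B : topologicalType) (f g : Z -> B) z :
  {for z, continuous f} -> (\forall y \near z, f y = g y) ->
  {for z, continuous g}.
Proof.
move=> cf fg V; rewrite -(nbhs_singleton fg) => /cf fV.
by apply: (@filterS2 _ (nbhs z) _ _ _ _ _ fg fV) => y /= <-.
Qed.

Lemma continuous_eq1 (Z B : topologicalType) (f g : Z -> B) z :
  {for z, continuous f} -> f =1 g -> {for z, continuous g}.
Proof. by move=> + /funext <-. Qed.

Lemma continuous_pair (Z A B : topologicalType) (f : Z -> A) (g : Z -> B) z :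
  {for z, continuous f} -> {for z, continuous g} ->
  {for z, continuous (fun z => (f z, g z))}.
Proof. by move=> fz gz; exact: cvg_pair. Qed.

Lemma continuous_fst_comp (A B C : topologicalType) (c : A -> C) :
  continuous c -> continuous (fun p : A * B => c p.1).
Proof.
move=> cc p.
exact: (@continuous_comp (A * B)%type A C fst c p cvg_fst (cc _)).
Qed.

Lemma continuous_pairr (A B C : topologicalType) (H : A * B -> C) (a : A)
    (b : B) : {for (a, b), continuous H} -> {for b, continuous (fun b => H (a,
      b))}.
Proof.
move=> cH; apply: (@continuous_comp B _ C (fun b => (a, b)) H) => //.
by apply: continuous_pair; [exact: cvg_cst|exact: cvg_id].
Qed.

Section weak_realization_topology.
Context {R : realType} {K : simplicial_complex}.
Local Notation N := (metric_realization R K).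
Local Notation Nw := (weak_realization R K).

Lemma near_supp (x : N) : \forall y \near x, (supp x `<=` supp y)%fset.
Proof.
have : \forall y \near x, forall v, v \in supp x -> 0 < bary y v.
  apply: (@near_fset _ (nbhs x) _) => v; rewrite -bary_gt0 => xv.
  exact: (cvgr_gt (bary x v) (@continuous_bary _ _ v x)).
by apply: filterS => y xy; apply/fsubsetP => v vx; rewrite -bary_gt0; exact: xy.
Qed.

(** Traces of metric-open sets on the same carrier allow weak continuity to be checked with the
    metric, one simplex at a time. *)
Lemma weak_openP (W : set Nw) : open W <->
  forall s : {fset K}, simplex s -> exists2 W' : set N, open W' &
    forall x : N, (supp x `<=` s)%fset -> W' x <-> W x.
Proof.
rewrite open_weakE; split=> oW s /oW.
  move=> /open_subspaceP [W' oW' WW']; exists W' => // x xs.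
  have /seteqP[WW W'W] := WW'.
  by split => Wx; [have [] := WW x (conj Wx xs)|have [] := W'W x (conj Wx xs)].
case=> W' oW' WW'; apply/open_subspaceP; exists W' => //.
by apply/seteqP; split=> x /= [Wx xs]; split => //; apply/(WW' x xs).
Qed.

Lemma continuous_weak_metric : continuous (idfun : Nw -> N).
Proof.
move=> x B; rewrite nbhsE => -[W [oW Wx] WB].
rewrite nbhsE; exists W => //; split => //.
by apply/weak_openP => s _; exists W.
Qed.

(** Near [z] the values lie in the finitely many simplices on vertices of [S]; on each of these a
    weakly open set is the trace of a metric-open one, and finitely many neighbourhoods can be
    intersected. *)
Lemma continuous_locally_finite (Z : topologicalType) (a : Z -> N) (z : Z)
    (S : {fset K}) : {for z, continuous a} ->
  (\forall y \near z, (supp (a y) `<=` S)%fset) ->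
  {for z, continuous (a : Z -> Nw)}.
Proof.
move=> az aS B; rewrite [in X in X -> _]nbhsE => -[W [/weak_openP oW Oaz] WB].
(* This puts [a z] in the closed simplex spanned by [supp (a y)], where the trace is taken. *)
have sz : \forall y \near z, (supp (a z) `<=` supp (a y))%fset.
  exact: az (near_supp (a z)).
have Ws : \forall y \near z, forall s, s \in fpowerset S ->
    simplex s -> (supp (a z) `<=` s)%fset -> (supp (a y) `<=` s)%fset ->
    W (a y).
  apply: (@near_fset _ (nbhs z) _) => s _.
  have [sK|nsK] := pselect (simplex s); last by apply: nearW.
  have [W' oW' WW'] := oW s sK.
  have [zs|nzs] := boolP (supp (a z) `<=` s)%fset; last by apply: nearW.
  have : \forall y \near z, W' (a y).
    by apply: az; apply: open_nbhs_nbhs; split => //; apply/(WW' _ zs).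
  by apply: filterS => y W'y _ _ ys; exact/(WW' _ ys).
have : \forall y \near z, W (a y).
  near=> y.
  have /(_ (supp (a y))) : forall s, s \in fpowerset S -> simplex s ->
    (supp (a z) `<=` s)%fset -> (supp (a y) `<=` s)%fset -> W (a y) by near: y.
  apply; [|exact: supp_simplex| |exact: fsubset_refl].
    by rewrite fpowersetE; near: y.
  by near: y.
by apply: filterS => y /WB.
Unshelve. all: by end_near. Qed.

(** The domain is a product with the weak topology, where simplexwise continuity does not suffice
    formally. Compactness of a time interval supplies the missing tube: the points whose whole time
    segment is sent into [W] form a weakly open set. *)
Lemma continuous_simplexwise (H : N * R -> N) : continuous H ->
  (forall s : {fset K}, simplex s -> exists2 s' : {fset K}, simplex s' &
     forall x t, (supp x `<=` s)%fset -> (supp (H (x, t)) `<=` s')%fset) ->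
  continuous (H : Nw * R -> Nw).
Proof.
move=> cH Hs [x0 t0] B; rewrite [in X in X -> _]nbhsE => -[W [oW OH] WB].
move/weak_openP: (oW) => wW.
(* With [x0] fixed the path stays in one closed simplex, so metric continuity in time gives [e]. *)
have [e e0 eW] : exists2 e : R, 0 < e &
    forall t, `[t0 - e, t0 + e]%classic t -> W (H (x0, t)).
  have [s' s'K Hs'] := Hs _ (supp_simplex x0).
  have [W' oW' WW'] := wW _ s'K.
  have : \forall t \near t0, W' (H (x0, t)).
    have := @continuous_pairr N R N H x0 t0 (cH _); apply.
    by apply: open_nbhs_nbhs; split => //; apply/(WW' _ (Hs' _ _ _)).
  move=> /nbhs_closedballP[e eW']; exists e%:num => // t te.
  apply/(WW' _ (Hs' _ _ (fsubset_refl _))); apply: eW'.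
  by rewrite closed_ballE//= /closed_ball_/= ler_distl; move: te;
     rewrite /= in_itv/= => /andP[]; lra.
pose V : set Nw := [set x | forall t, `[t0 - e, t0 + e]%classic t -> W (H (x,
  t))].
have oV : open V.
  apply/weak_openP => s sK; have [s' s'K Hs'] := Hs s sK.
  have [W' oW' WW'] := wW _ s'K.
  exists [set x | forall t, `[t0 - e, t0 + e]%classic t -> W' (H (x, t))].
    rewrite openE => x Vx.
    have /compact_near_coveringP/(_ N (nbhs (x : N)) (fun x t => W' (H (x,
      t))) _) :=
      @segment_compact R (t0 - e) (t0 + e).
    apply => t te.
    have : \forall p \near (x, t), W' (H p).
      by apply: cH; apply: open_nbhs_nbhs; split => //; exact: Vx.
    case=> -[A1 A2] /= [A1x A2t] AW'; exists (A2, A1) => //= -[t' x'] /= [? ?].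
    exact: (AW' (x', t')).
  move=> x xs; split => /= Vx t /Vx Wx; exact/(WW' _ (Hs' _ _ xs)).
exists (V, ball t0 e) => /=.
  split; last exact: nbhsx_ballx.
  by apply: open_nbhs_nbhs; split.
move=> [x t] /= [Vx te]; apply: WB; apply: Vx.
by move: te; rewrite /ball/= in_itv/= ltr_distlC => /andP[? ?]; rewrite !ltW.
Qed.

End weak_realization_topology.

(** * Homotopies *)

Section homotopy.
Context {R : realType}.

Lemma cvg_maxr (T : Type) (F : set_system T) {FF : Filter F} (f g : T -> R)
    (a b : R) : f @ F --> a -> g @ F --> b ->
  Num.max (f x) (g x) @[x --> F] --> Num.max a b.
Proof.
move=> fa gb; rewrite maxr_absE; under eq_fun do rewrite maxr_absE.
apply: cvgMr_tmp; apply: cvgD; first exact: cvgD.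
by apply: cvg_norm; exact: cvgB.
Qed.

Lemma cvg_minr (T : Type) (F : set_system T) {FF : Filter F} (f g : T -> R)
    (a b : R) : f @ F --> a -> g @ F --> b ->
  Num.min (f x) (g x) @[x --> F] --> Num.min a b.
Proof.
move=> fa gb; rewrite minr_absE; under eq_fun do rewrite minr_absE.
apply: cvgMr_tmp; apply: cvgB; first exact: cvgD.
by apply: cvg_norm; exact: cvgB.
Qed.

Lemma cvg_sum_seq (T : Type) (F : set_system T) {FF : Filter F} (J : Type)
    (s : seq J) (f : J -> T -> R) (a : J -> R) :
  (forall j, f j @ F --> a j) ->
  (\sum_(j <- s) f j x) @[x --> F] --> \sum_(j <- s) a j.
Proof.
move=> fa; elim: s => [|j s IH].
  by rewrite big_nil; under eq_fun do rewrite big_nil; exact: cvg_cst.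
rewrite big_cons; under eq_fun do rewrite big_cons.
by apply: cvgD => //; exact: fa.
Qed.

(** Precomposing with this retraction onto the unit interval makes a homotopy continuous on all of
    [A * R], which avoids subspace topologies afterwards. *)
Definition clamp (t : R) : R := Num.max 0 (Num.min 1 t).

Lemma clamp_ge0 t : 0 <= clamp t.
Proof. by rewrite le_max lexx. Qed.

Lemma clamp_le1 t : clamp t <= 1.
Proof. by rewrite ge_max ler01 ge_min lexx. Qed.

Lemma clamp_le0 t : t <= 0 -> clamp t = 0.
Proof.
by move=> t0; rewrite /clamp (min_idPr _) ?(le_trans t0)//; exact/max_idPl.
Qed.

Lemma clamp_ge1 t : 1 <= t -> clamp t = 1.
Proof. by move=> t1; rewrite /clamp (min_idPl _)//; exact/max_idPr. Qed.

Lemma cvg_clamp (T : Type) (F : set_system T) {FF : Filter F} (f : T -> R)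
    (a : R) : f @ F --> a -> clamp (f x) @[x --> F] --> clamp a.
Proof.
by move=> fa; apply: cvg_maxr; [exact: cvg_cst|apply: cvg_minr => //;
  exact: cvg_cst].
Qed.

Lemma homotopicI (A B : topologicalType) (f g : A -> B) (H : A * R -> B) :
  continuous H -> (forall x, H (x, 0) = f x) -> (forall x, H (x, 1) = g x) ->
  homotopic R f g.
Proof. by move=> cH H0 H1; exists H; split => //;
  exact: continuous_subspaceT. Qed.

Lemma continuous_clamp_within (A B : topologicalType) (H : A * R -> B) :
  {within [set: A] `*` `[0, 1], continuous H} ->
  continuous (fun p => H (p.1, clamp p.2)).
Proof.
move=> /subspace_continuousP cH [x t] /=.
have D p : ([set: A] `*` `[0, 1]%classic) (p.1, clamp p.2).
  by split => //=; rewrite in_itv/= clamp_ge0 clamp_le1.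
move=> V nV; have nV' := cH (x, clamp t) (D (x, t)) V nV.
have c : {for (x, t), continuous (fun p : A * R => (p.1, clamp p.2))}.
  by apply: continuous_pair; [exact: cvg_fst|apply: cvg_clamp; exact: cvg_snd].
by have := c _ nV'; rewrite /nbhs/=; apply: filterS => p /(_ (D p)).
Qed.

Lemma continuous_reparam (A B : topologicalType) (H : A * R -> B) (u : R -> R) :
  {within [set: A] `*` `[0, 1], continuous H} -> continuous u ->
  continuous (fun p : A * R => H (p.1, clamp (u p.2))).
Proof.
move=> /continuous_clamp_within cH cu [x t].
apply: (@continuous_comp (A * R)%type (A * R)%type B (fun p => (p.1, u p.2))
  (fun p => H (p.1, clamp p.2))); last exact: cH.
apply: continuous_pair; first exact: cvg_fst.
exact: (@continuous_comp (A * R)%type R R snd u _ cvg_snd (cu _)).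
Qed.

Lemma homotopic_sym (A B : topologicalType) (f g : A -> B) :
  homotopic R f g -> homotopic R g f.
Proof.
move=> [H [cH H0 H1]].
apply: (@homotopicI _ _ _ _ (fun p => H (p.1, clamp (1 - p.2)))).
- apply: (continuous_reparam (u := fun t => 1 - t)) => // t.
  by apply: cvgB; [exact: cvg_cst|exact: cvg_id].
- by move=> x /=; rewrite subr0 clamp_ge1.
- by move=> x /=; rewrite subrr clamp_le0.
Qed.

Lemma homotopic_trans (A B : topologicalType) (g f h : A -> B) :
  homotopic R f g -> homotopic R g h -> homotopic R f h.
Proof.
move=> [H [cH H0 H1]] [H' [cH' H'0 H'1]].
pose L (p : A * R) := H (p.1, clamp (2 * p.2));
  pose L' (p : A * R) := H' (p.1, clamp (2 * p.2 - 1)).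
have c2 : continuous (fun t : R => 2 * t).
  by move=> t; apply: cvgMl_tmp; exact: cvg_id.
have cL : continuous L by exact: (continuous_reparam (u := fun t => 2 * t)).
have cL' : continuous L'.
  apply: (continuous_reparam (u := fun t => 2 * t - 1)) => // t.
  by apply: cvgB; [exact: c2|exact: cvg_cst].
apply: (@homotopicI _ _ _ _ (fun p : A * R =>
  if p.2 <= 2^-1 then L p else L' p)).
- move=> [x t] /=.
  have [t2|t2|t2] := ltgtP t 2^-1.
  + apply: (continuous_near_eq (cL (x, t))).
    have : \forall p \near (x, t), p.2 < 2^-1.
      by apply: (@cvgr_lt R _ (nbhs (x, t)) _ snd t) => //; exact: cvg_snd.
    by apply: filterS => p /ltW ->.
  + apply: (continuous_near_eq (cL' (x, t))).
    have : \forall p \near (x, t), 2^-1 < p.2.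
      by apply: (@cvgr_gt R _ (nbhs (x, t)) _ snd t) => //; exact: cvg_snd.
    by apply: filterS => p p2; rewrite leNgt p2.
  (* At time 1/2 both halves take the value of [g], so a neighbourhood good for both works whichever
     branch applies. *)
  + move=> V nV.
    have L't : L' (x, t) = L (x, t).
      rewrite /L /L'/= t2 mulfV// subrr clamp_le0// clamp_ge1//.
      by rewrite H1 H'0.
    move: nV; rewrite /= t2 lexx -t2 => nV.
    have nV' : nbhs (L' (x, t)) V by rewrite L't.
    apply: (@filterS2 _ (nbhs (x, t)) _ _ _ _ _ (cL _ _ nV) (cL' _ _ nV')).
    by move=> p /= ? ?; case: ifP.
- by move=> x /=; rewrite invr_ge0 ler0n /L/= mulr0 clamp_le0.
- move=> x /=; rewrite leNgt invf_lt1// ltr1n /L'/= mulr1.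
  by rewrite clamp_ge1 ?H'1//; lra.
Qed.

End homotopy.

(** * Maps into the realization *)

Section barycentric_maps.
Context {R : realType} {K : simplicial_complex}.
Local Notation N := (metric_realization R K).
Local Notation Nw := (weak_realization R K).

(** The exact support need not be known beforehand: [S] only has to contain it, and total weight 1
    keeps it nonempty. *)
Lemma realization_of_weights (w : K -> R) (S : {fset K}) :
  (forall v, 0 <= w v) -> (forall v, w v != 0 -> v \in S) ->
  \sum_(v <- S) w v = 1 ->
  (forall s : {fset K}, s != fset0 -> (forall v, v \in s -> w v != 0) ->
    simplex s) ->
  exists x : N, forall v, bary x v = w v.
Proof.
move=> w0 wS w1 ws; pose x : fin_l2 R K := [fsfun v in S => w v].
have xE v : x v = w v.
  by rewrite fsfunE; case: ifPn => // vS; apply/esym; apply: contraNeq vS;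
    exact: wS.
have sx : barycentric x.
  have xS : (finsupp x `<=` S)%fset.
    by apply/fsubsetP => v; rewrite mem_finsupp xE; exact: wS.
  have sumx : \sum_(v <- finsupp x) x v = 1.
    transitivity (\sum_(v <- S) x v); last by rewrite -w1; apply: eq_bigr.
    by apply: big_fset_incl => // v _; rewrite memNfinsupp => /eqP.
  split => // [|v]; last by rewrite xE.
  apply: ws => [|v]; last by rewrite mem_finsupp xE.
  by apply: contra_eq_neq sumx => ->; rewrite big_seq_fset0 eq_sym oner_eq0.
by exists (SigSub (mem_set sx)) => v; rewrite -xE.
Qed.

(** This condition upgrades metric continuity to weak continuity, see [continuous_weak]. *)
Definition locally_finite_map (Z : topologicalType) (a : Z -> N) : Prop :=
  forall z : Z, exists S : {fset K}, \forall y \near z,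
    (supp (a y) `<=` S)%fset.

(** Division by the sum of the weights, which is positive and locally a finite sum of continuous
    functions. It serves both for the map out of [Y] and for the collapse of the realization. *)
Lemma normalize (Z : topologicalType) (b : Z -> K -> R) :
  (forall v, continuous (b ^~ v)) -> (forall z v, 0 <= b z v) ->
  (forall z : Z, exists S : {fset K},
     \forall y \near z, forall v, b y v != 0 -> v \in S) ->
  (forall z, exists v, b z v != 0) ->
  (forall z (s : {fset K}), s != fset0 -> (forall v, v \in s -> b z v != 0) ->
    simplex s) ->
  exists a : Z -> N, [/\ continuous a, locally_finite_map a &
    forall z v, (v \in supp (a z)) = (b z v != 0)].
Proof.
move=> cb b0 /choice[S bS] bn0 bs.
have bSz z v : b z v != 0 -> v \in S z by have /nbhs_singleton := bS z; exact.
pose t z := \sum_(v <- S z) b z v.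
have t0 z : 0 < t z.
  have [v bv] := bn0 z; rewrite /t (big_fsetD1 v) ?bSz//= ltr_pwDl//.
    by rewrite lt_neqAle eq_sym bv b0.
  by apply: sumr_ge0 => w _; exact: b0.
have : forall z, exists x : N, forall v, bary x v = b z v / t z.
  move=> z; apply: (@realization_of_weights _ (S z)).
  - by move=> v; rewrite divr_ge0// ltW.
  - by move=> v; rewrite mulf_eq0 negb_or => /andP[/bSz].
  - by rewrite -mulr_suml divff ?gt_eqF ?t0.
  - move=> s s0 sb; apply: (bs z) => // v /sb.
    by rewrite mulf_eq0 negb_or => /andP[].
move=> /choice[a aE].
have ct : continuous t.
  (* The index set [S y] varies with [y]; near [z] the sums over [S y] and [S z] agree, since both
     reduce to the nonzero weights. *)
  move=> z; apply: (@continuous_near_eq _ _ (fun y => \sum_(v <- S z) b y v)).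
    by apply: cvg_sum_seq => v; exact: cb.
  near=> y; have yS : forall v, b y v != 0 -> v \in S z by near: y; exact: bS.
  have sub v : b y v != 0 -> v \in [fset v in S z | b y v != 0]%fset.
    by move=> bv; rewrite !inE/= bv yS.
  transitivity (\sum_(v <- [fset v in S z | b y v != 0]%fset) b y v).
    apply/esym/big_fset_incl; first by apply/fsubsetP => v;
      rewrite !inE => /andP[].
    by move=> v _; apply: contraNeq; exact: sub.
  apply: big_fset_incl; last by move=> v _; apply: contraNeq; exact: sub.
  by apply/fsubsetP => v; rewrite !inE/= => /andP[_ /bSz].
have asupp z v : (v \in supp (a z)) = (b z v != 0).
  by rewrite in_supp aE mulf_eq0 negb_or invr_eq0 (gt_eqF (t0 z)) andbT.
exists a; split => //.
- move=> z; apply: continuous_realization => v.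
  apply: (@continuous_eq1 _ _ (fun y => b y v / t y)); last by move=> y;
    rewrite aE.
  by apply: cvgM; [exact: cb|apply: cvgV; [rewrite gt_eqF|exact: ct]].
- move=> z; exists (S z); have := bS z; apply: filterS => y yS.
  by apply/fsubsetP => v; rewrite asupp; exact: yS.
Unshelve. all: by end_near. Qed.

Lemma segment_ex (x y : N) (c : R) : 0 <= c <= 1 ->
  simplex (supp x `|` supp y)%fset ->
  exists z : N, forall v, bary z v = (1 - c) * bary x v + c * bary y v.
Proof.
move=> /andP[c0 c1] sxy.
have w0 v : (1 - c) * bary x v + c * bary y v != 0 ->
    v \in (supp x `|` supp y)%fset.
  apply: contraNT; rewrite inE !in_supp negb_or !negbK.
  by move=> /andP[/eqP -> /eqP ->]; rewrite !mulr0 addr0.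
apply: (@realization_of_weights _ (supp x `|` supp y)%fset) => //.
- by move=> v; rewrite addr_ge0// mulr_ge0 ?bary_ge0// subr_ge0.
- rewrite big_split/= -!mulr_sumr !sum_bary_widen ?fsubsetUl ?fsubsetUr//.
  by rewrite !mulr1 subrK.
- move=> s s0 sw; apply: (simplex_sub sxy) => //.
  by apply/fsubsetP => v /sw/w0.
Qed.

(** Points whose supports span a common simplex are joined by a straight segment in it. The bound on
    the supports is what the weak topology requires of the homotopy. *)
Lemma segment_homotopy (Z : topologicalType) (a b : Z -> N) :
  continuous a -> continuous b ->
  (forall z, simplex (supp (a z) `|` supp (b z))%fset) ->
  exists H : Z * R -> N, [/\ continuous H, forall z, H (z, 0) = a z,
    forall z, H (z, 1) = b z &
    forall z t, (supp (H (z, t)) `<=` supp (a z) `|` supp (b z))%fset].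
Proof.
move=> ca cb sab.
have : forall p : Z * R, exists x : N, forall v, bary x v =
    (1 - clamp p.2) * bary (a p.1) v + clamp p.2 * bary (b p.1) v.
  by move=> p; apply: segment_ex => //; rewrite clamp_ge0 clamp_le1.
move=> /choice[H HE]; exists H; split.
- move=> p; apply: continuous_realization => v.
  apply: (@continuous_eq1 _ _ (fun p : Z * R =>
      (1 - clamp p.2) * bary (a p.1) v + clamp p.2 * bary (b p.1) v));
        last first.
    by move=> y; rewrite HE.
  have cc : {for p, continuous (fun p : Z * R => clamp p.2)}.
    by apply: cvg_clamp; exact: cvg_snd.
  have cf (c : Z -> N) : continuous c ->
      {for p, continuous (fun p : Z * R => bary (c p.1) v)}.
    move=> cc'; have cz : continuous (fun z => bary (c z) v : R).
      by move=> z; apply: continuous_bary_comp; exact: cc'.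
    exact: (@continuous_fst_comp Z R R _ cz p).
  apply: cvgD; apply: cvgM => //; try exact: cf.
  by apply: cvgB => //; exact: cvg_cst.
- move=> z; apply: realization_eq => v.
  by rewrite HE/= clamp_le0// subr0 mul1r mul0r addr0.
- move=> z; apply: realization_eq => v.
  by rewrite HE/= clamp_ge1// subrr mul1r mul0r add0r.
- move=> z t; apply/fsubsetP => v; apply: contraLR.
  rewrite inE !in_supp negb_or !negbK HE => /andP[/eqP -> /eqP ->].
  by rewrite !mulr0 addr0.
Qed.

Lemma segment_homotopic (Z : topologicalType) (a b : Z -> N) :
  continuous a -> continuous b ->
  (forall z, simplex (supp (a z) `|` supp (b z))%fset) -> homotopic R a b.
Proof.
by move=> ca cb /(segment_homotopy ca cb)[H [cH H0 H1 _]];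
  exact: homotopicI H0 H1.
Qed.

Lemma continuous_weak (Z : topologicalType) (a : Z -> N) : continuous a ->
  locally_finite_map a -> continuous (a : Z -> Nw).
Proof.
by move=> ca fa z; have [S aS] := fa z;
  exact: (continuous_locally_finite (ca z) aS).
Qed.

Lemma segment_homotopic_weak (Z : topologicalType) (a b : Z -> N) :
  continuous a -> continuous b ->
  locally_finite_map a -> locally_finite_map b ->
  (forall z, simplex (supp (a z) `|` supp (b z))%fset) ->
  homotopic R (a : Z -> Nw) (b : Z -> Nw).
Proof.
move=> ca cb fa fb /(segment_homotopy ca cb)[H [cH H0 H1 Hs]].
apply: (@homotopicI _ _ _ _ _ (H : Z * R -> Nw)) => //.
apply: continuous_weak => // -[z t].
have [S aS] := fa z; have [T bT] := fb z; exists (S `|` T)%fset.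
exists ([set y | (supp (a y) `<=` S)%fset /\ (supp (b y) `<=` T)%fset], setT).
  by split; [exact: filterI aS bT|exact: filterT].
move=> [y u] /= [[yS yT] _].
by apply: fsubset_trans (Hs y u) _; exact: fsetUSS.
Qed.

End barycentric_maps.

(** * Iterated contractions *)

Section iterated_contraction.
Context {R : realType} {V : choiceType} {Y : topologicalType} (U : V -> set Y).

(** The empty set gives all of [Y]; this is why contractions are only asked for when
    [s != fset0]. *)
Definition inter (s : {fset V}) : set Y := [set y | forall v, v \in s -> U v y].

(** Contractions with unrestricted time: nothing moves up to time 0, and from time 1 on the starting
    point is forgotten. *)
Context (k : {fset V} -> Y -> R -> Y).
Context (k_le0 : forall s y t, s != fset0 -> inter s y -> t <= 0 ->
  k s y t = y).
Context (k_ge1 : forall s y z t, s != fset0 -> inter s y -> inter s z ->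
  1 <= t -> k s y t = k s z t).
Context (k_inter : forall s y t, s != fset0 -> inter s y -> inter s (k s y t)).
Context (k_continuous : forall s y t, s != fset0 -> inter s y ->
  {for (y, t), continuous (fun p : Y * R => k s p.1 p.2)}).
Implicit Types (q : V -> R) (s t : {fset V}) (l : seq V) (c : R) (v w : V) (y
  : Y).

Local Notation "[ 'set_of' l ]" := [fset x in (l : seq V)]%fset.

Lemma inter_sub (s t : {fset V}) : (s `<=` t)%fset -> inter t `<=` inter s.
Proof. by move=> /fsubsetP st y ty v /st/ty. Qed.

Lemma set_of_cons_neq0 v l : [set_of v :: l] != fset0.
Proof. by apply/fset0Pn; exists v; rewrite !inE eqxx. Qed.

Lemma set_of_sub_cons v l : ([set_of l] `<=` [set_of v :: l])%fset.
Proof. by apply/fsubsetP => w; rewrite !inE => ->; rewrite orbT. Qed.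

(* If [l] is sorted by [q] then the suffixes of [l] are the superlevel sets of
   [q]; the contraction of each of them runs for a time equal to the width of
   the interval of levels where it occurs, starting with the largest set. *)
Fixpoint flow (q : V -> R) (l : seq V) (c : R) (y : Y) : Y :=
  if l is v :: l' then flow q l' (q v) (k [set_of l] y (q v - c)) else y.

Local Notation sorted_by q := (sorted (relpre q <=%O)).

Lemma sorted_by_cons q v l : sorted_by q (v :: l) ->
  sorted_by q l /\ forall w, w \in l -> q v <= q w.
Proof.
move=> /= vl; split; first exact: path_sorted vl.
apply/allP; apply: (order_path_min _ vl) => a b c.
exact: le_trans.
Qed.

Lemma sorted_by_last q v l w : sorted_by q (v :: l) -> w \in v :: l ->
  q w <= q (last v l).
Proof.
elim: l v w => [|u l IH] v w; first by rewrite inE => _ /eqP ->.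
move=> /sorted_by_cons[sl vl]; rewrite inE => /predU1P[->|]; last exact: IH.
by apply: (le_trans (vl u (mem_head _ _))); exact: (IH u u sl (mem_head _ _)).
Qed.

Lemma flow_const q l c y : (forall v, v \in l -> q v = c) ->
  inter [set_of l] y -> flow q l c y = y.
Proof.
elim: l y => [//|v l IH] y lc ly.
have vc : q v = c by apply: lc; rewrite mem_head.
rewrite /= vc subrr k_le0 ?set_of_cons_neq0//; apply: IH.
  by move=> w wl; apply: lc; rewrite inE wl orbT.
exact: (inter_sub (set_of_sub_cons _ _) ly).
Qed.

(** Vertices at the base level [c] come first in the sorted list, and their contractions run for
    time 0. *)
Lemma flow_filter q l c y : sorted_by q l -> (forall v, v \in l -> c <= q v) ->
  inter [set_of l] y -> flow q l c y = flow q [seq v <- l | c < q v] c y.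
Proof.
elim: l y => [//|v l IH] y /sorted_by_cons[sl vl] cl ly.
have := cl v (mem_head _ _); rewrite le_eqVlt => /predU1P[cv|cv].
  rewrite [LHS]/= [RHS]/= -cv ltxx subrr k_le0 ?set_of_cons_neq0//;
    apply: IH => //.
    by move=> w wl; apply: cl; rewrite inE wl orbT.
  exact: (inter_sub (set_of_sub_cons _ _) ly).
rewrite (_ : [seq w <- _ | _] = v :: l)//; apply/all_filterP/allP => w.
by rewrite inE => /predU1P[->//|/vl]; exact: lt_le_trans.
Qed.

(** Neither the order among ties nor the vertices at the base level matter. After filtering, both
    lists have the same vertices and the same lowest level, so the first contraction is the same;
    the tails are compared with the base raised to that level, where remaining ties are filtered
    again. *)
Lemma flow_eq_mem q l l' c y : sorted_by q l -> sorted_by q l' ->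
  (forall v, v \in l -> c <= q v) -> (forall v, v \in l' -> c <= q v) ->
  (forall v, c < q v -> (v \in l) = (v \in l')) ->
  inter [set_of l] y -> inter [set_of l'] y ->
  flow q l c y = flow q l' c y.
Proof.
(* Filtering prevents a structural induction on [l], hence the induction on a size bound. *)
have [n] := ubnP (size l); elim: n l l' c y => // n IH l l' c y ln sl sl' cl
  cl' ll' ly l'y.
rewrite flow_filter// [RHS]flow_filter//.
pose m := [seq v <- l | c < q v]; pose m' := [seq v <- l' | c < q v].
rewrite -/m -/m'.
have tr : transitive (relpre q <=%O) by move=> a b d; exact: le_trans.
have sm : sorted_by q m by exact: sorted_filter.
have sm' : sorted_by q m' by exact: sorted_filter.
have mm' : m =i m'.
  by move=> v; rewrite !mem_filter; have [/= /ll'|] := ltP c (q v).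
have my : inter [set_of m] y.
  apply: inter_sub ly; apply/fsubsetP => v; rewrite !inE mem_filter.
  by case/andP.
have mc v : v \in m -> c < q v by rewrite mem_filter => /andP[].
have : (size m < n.+1)%N.
  by apply: leq_ltn_trans ln; rewrite size_filter count_size.
case: m m' => [|v m] [|v' m'] in sm sm' mm' my mc *.
- by [].
- by move=> _; have := mm' v'; rewrite !inE eqxx.
- by move=> _; have := mm' v; rewrite !inE eqxx.
move=> mn; have [sm1 vm] := sorted_by_cons sm;
  have [sm1' vm'] := sorted_by_cons sm'.
have vv' : q v = q v'.
  apply/eqP; rewrite eq_le; apply/andP; split.
    have : v' \in v :: m by rewrite mm' mem_head.
    by rewrite inE => /predU1P[->|/vm].
  have : v \in v' :: m' by rewrite -mm' mem_head.
  by rewrite inE => /predU1P[->|/vm'].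
have eqs : [set_of v :: m] = [set_of v' :: m'].
  by apply/fsetP => w; rewrite !inE; have := mm' w; rewrite !inE.
have ky : inter [set_of v :: m] (k [set_of v :: m] y (q v - c)).
  by apply: k_inter => //; exact: set_of_cons_neq0.
rewrite /= -vv' -eqs; apply: IH => //.
- by move=> w /vm'; rewrite vv'.
- move=> w vw; have := mm' w; rewrite !inE.
  have /negPf -> : w != v by apply: contraTneq vw => ->; rewrite ltxx.
  by have /negPf -> : w != v' by apply: contraTneq vw => ->; rewrite vv' ltxx.
- exact: (inter_sub (set_of_sub_cons _ _) ky).
- by rewrite eqs in ky *; exact: (inter_sub (set_of_sub_cons _ _) ky).
Qed.

(* A large gap of levels occurs, whose contraction forgets the base point. *)
Lemma flow_forget q v l c y z :
  (size (v :: l))%:R <= q (last v l) - c ->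
  inter [set_of v :: l] y -> inter [set_of v :: l] z ->
  flow q (v :: l) c y = flow q (v :: l) c z.
Proof.
elim: l v c y z => [|w l IH] v c y z.
  by move=> qv vy vz; rewrite /= (@k_ge1 _ y z)// set_of_cons_neq0.
move=> ql vy vz; rewrite [LHS]/= [RHS]/=.
(* If the first gap is below 1, dropping it lowers the total rise by less than 1 while the list
   loses one entry, so the bound survives. *)
have [q1|q1] := leP 1 (q v - c); first by rewrite (@k_ge1 _ y z)//
  set_of_cons_neq0.
apply: IH; last 2 first.
- apply: (inter_sub (set_of_sub_cons v _)); apply: k_inter => //.
  exact: set_of_cons_neq0.
- apply: (inter_sub (set_of_sub_cons v _)); apply: k_inter => //.
  exact: set_of_cons_neq0.
by move: ql q1; rewrite /= -natr1; lra.
Qed.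

(** As long as [w] is in the list the contractions stay inside [U w]; beyond [w] all levels equal
    [q w], so nothing moves any more. *)
Lemma flow_in q l c y w : sorted_by q l -> w \in l ->
  (forall v, v \in l -> q v <= q w) -> inter [set_of l] y -> U w (flow q l c y).
Proof.
elim: l c y => // v l IH c y /sorted_by_cons[sl vl] wl lw ly.
have ky : inter [set_of v :: l] (k [set_of v :: l] y (q v - c)).
  by apply: k_inter => //; exact: set_of_cons_neq0.
have kl := inter_sub (set_of_sub_cons _ _) ky.
have lw' u : u \in l -> q u <= q w by move=> ul; apply: lw; rewrite inE ul orbT.
have [wl'|wl'] := boolP (w \in l); first exact: IH.
move: wl; rewrite inE (negPf wl') orbF => /eqP wv.
rewrite /= flow_const//; last first.
  by move=> u ul; apply/eqP; rewrite eq_le vl// -wv lw'.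
by apply: ky; rewrite wv !inE eqxx.
Qed.

Lemma continuous_flow (Z : topologicalType) (z0 : Z) (q : Z -> V -> R)
    (c : Z -> R) (y : Z -> Y) l :
  (forall v, v \in l -> {for z0, continuous (q ^~ v)}) ->
  {for z0, continuous c} -> {for z0, continuous y} ->
  inter [set_of l] (y z0) ->
  {for z0, continuous (fun z => flow (q z) l (c z) (y z))}.
Proof.
elim: l c y => // v l IH c y cq cc cy ly.
have cv : {for z0, continuous (q ^~ v)} by apply: cq; rewrite mem_head.
rewrite /=; apply: IH => //.
- by move=> w wl; apply: cq; rewrite inE wl orbT.
- apply: (@continuous_comp Z (Y * R)%type Y (fun z => (y z, q z v - c z))
    (fun p => k [set_of v :: l] p.1 p.2)).
    by apply: continuous_pair => //; exact: cvgB.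
  exact: k_continuous (set_of_cons_neq0 _ _) ly.
- apply: (inter_sub (set_of_sub_cons v _)); apply: k_inter => //.
  exact: set_of_cons_neq0.
Qed.

(** For starting points in the intersections involved, vertices at level 0 have no effect
    ([sflow_eq_mem]); so [s] can be frozen while the levels vary. *)
Definition sflow (s : {fset V}) (q : V -> R) (y : Y) : Y :=
  flow q (sort (relpre q <=%O) (enum_fset s)) 0 y.

Lemma sort_by_sorted q (s : seq V) : sorted_by q (sort (relpre q <=%O) s).
Proof. by apply: sort_sorted => a b; exact: le_total. Qed.

Lemma set_of_sort q (s : {fset V}) :
  [set_of sort (relpre q <=%O) (enum_fset s)] = s.
Proof. by apply/fsetP => v; rewrite !inE mem_sort. Qed.

Lemma sflow_eq_mem s t q y : (forall v, 0 <= q v) ->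
  inter s y -> inter t y -> (forall v, 0 < q v -> (v \in s) = (v \in t)) ->
  sflow s q y = sflow t q y.
Proof.
move=> q0 sy ty st; apply: flow_eq_mem; rewrite ?set_of_sort ?sort_by_sorted//.
by move=> v /st; rewrite !mem_sort.
Qed.

(** Both sets can be cut down to the vertices at positive level, which they share; the top level is
    then at least the length of the list, as [flow_forget] demands. *)
Lemma sflow_forget s t q y z w : (forall v, 0 <= q v) ->
  (forall v, 0 < q v -> (v \in s) && (v \in t)) ->
  0 < q w -> (#|` [fset v in s | (0 < q v)%R]%fset|)%:R <= q w ->
  inter s y -> inter t z -> sflow s q y = sflow t q z.
Proof.
move=> q0 st w0; set p := [fset v in s | _]%fset => pw sy tz.
have ps : (p `<=` s)%fset by apply/fsubsetP => v; rewrite !inE => /andP[].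
have pt : (p `<=` t)%fset.
  by apply/fsubsetP => v; rewrite !inE => /andP[_ /st/andP[]].
have pE v : 0 < q v -> v \in p by rewrite !inE => v0; rewrite v0 andbT;
  case/andP: (st v v0).
rewrite (@sflow_eq_mem s p)//; [|exact: inter_sub sy|]; last first.
  by move=> v v0; rewrite pE//; case/andP: (st v v0).
rewrite (@sflow_eq_mem t p)//; [|exact: inter_sub tz|]; last first.
  by move=> v v0; rewrite pE//; case/andP: (st v v0).
have py : inter [set_of sort (relpre q <=%O) (enum_fset p)] y.
  by rewrite set_of_sort; exact: inter_sub ps _ sy.
have pz : inter [set_of sort (relpre q <=%O) (enum_fset p)] z.
  by rewrite set_of_sort; exact: inter_sub pt _ tz.
rewrite /sflow; move: py pz.
have wp : w \in sort (relpre q <=%O) (enum_fset p) by rewrite mem_sort pE.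
have : (size (sort (relpre q <=%O) (enum_fset p)))%:R <= q w by rewrite
  size_sort.
have := sort_by_sorted q (enum_fset p).
case: (sort _ _) wp => // v l wl sl lw py pz; apply: flow_forget => //.
rewrite subr0; apply: le_trans lw _.
exact: sorted_by_last.
Qed.

Lemma sflow_in s q y w : inter s y -> w \in s ->
  (forall v, v \in s -> q v <= q w) -> U w (sflow s q y).
Proof.
move=> sy ws sw; apply: flow_in; rewrite ?set_of_sort ?mem_sort
  ?sort_by_sorted//.
by move=> v; rewrite mem_sort; exact: sw.
Qed.

Lemma sflow0 s q y : (forall v, q v = 0) -> inter s y -> sflow s q y = y.
Proof. by move=> q0 sy; apply: flow_const => //; rewrite set_of_sort. Qed.

(** The sorting order may jump at ties. Strict inequalities persist near [z0], so every order sorted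
    nearby is also sorted at [z0]; there are finitely many such orders, each gives a continuous
    flow, and all these flows agree at [z0] by [flow_eq_mem]. *)
Lemma continuous_sflow (Z : topologicalType) (z0 : Z) (q : Z -> V -> R)
    (y : Z -> Y) s :
  (forall z v, 0 <= q z v) -> (forall v, {for z0, continuous (q ^~ v)}) ->
  {for z0, continuous y} -> inter s (y z0) ->
  {for z0, continuous (fun z => sflow s (q z) (y z))}.
Proof.
move=> q0 cq cy sy B nB.
have lt_near v w : \forall z \near z0, q z0 v < q z0 w -> q z v < q z w.
  have [vw|] := ltP (q z0 v) (q z0 w); last by move=> _; apply: nearW.
  have : {for z0, continuous (fun z => q z w - q z v)}.
    by apply: cvgB; exact: cq.
  move=> /(@cvgr_gt R _ (nbhs z0) _ _ _) /(_ 0); rewrite subr_gt0 => /(_ vw).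
  by apply: filterS => z; rewrite subr_gt0.
have lt_near_s : \forall z \near z0, forall v, v \in s -> forall w, w \in s ->
    q z0 v < q z0 w -> q z v < q z w.
  apply: (@near_fset _ (nbhs z0) _) => v _;
    apply: (@near_fset _ (nbhs z0) _) => w _.
  exact: lt_near.
have B_near : \forall z \near z0, forall l, l \in permutations (enum_fset s) ->
    sorted_by (q z0) l -> B (flow (q z) l 0 (y z)).
  apply: (@near_seq _ (nbhs z0) _) => l; rewrite mem_permutations => ls.
  have [sl|_] := boolP (sorted_by (q z0) l); last by apply: nearW.
  have ly : inter [set_of l] (y z0).
    by move=> v; rewrite inE (perm_mem ls) => /sy.
  have := @continuous_flow Z z0 q (fun=> 0) y l (fun v _ => cq v) _ cy ly.
  move=> /(_ (@cst_continuous _ _ _ _))/(_ B).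
  rewrite (_ : flow _ _ _ _ = sflow s (q z0) (y z0)).
    by move=> /(_ nB); apply: (@filterS _ (nbhs z0)).
  apply: flow_eq_mem; rewrite ?set_of_sort ?sort_by_sorted//.
  by move=> v _; rewrite mem_sort (perm_mem ls).
apply: (@filterS2 _ (nbhs z0) _ _ _ _ _ lt_near_s B_near) => z zlt /=; apply.
  by rewrite mem_permutations perm_sort.
have : sorted_by (q z) (sort (relpre (q z) <=%O) (enum_fset s)).
  exact: sort_by_sorted.
have sub : {in mem s &, subrel (relpre (q z) <=%O) (relpre (q z0) <=%O)}.
  by move=> v w vs ws /=; apply: contraTT; rewrite -!ltNge; exact: zlt.
by apply: (sub_in_sorted sub); apply/allP => v; rewrite mem_sort.
Qed.

End iterated_contraction.

(** * Paracompact spaces *)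

Section paracompact.
Context {Y : topologicalType}.
Implicit Types (A B W : set Y) (D : set (set Y)).

Lemma closure_min A B : A `<=` B -> closed B -> closure A `<=` B.
Proof. by move=> /closureS + /closure_id => /[swap] <-. Qed.

(** Near a given point only finitely many members matter, and a finite union of closures is
    closed. *)
Lemma closure_locally_finite D D' : locally_finite D -> D' `<=` D ->
  closure (\bigcup_(W in D') W) `<=` \bigcup_(W in D') closure W.
Proof.
move=> lfD D'D y cy; have [N yN finN] := lfD y.
pose F := [set W | D' W /\ W `&` N !=set0].
have cF : closed (\bigcup_(W in F) closure W).
  apply: closed_bigcup; last by move=> W _; exact: closed_closure.
  by apply: sub_finite_set finN => W [/D'D].
suff [W [D'W _] Wy] : (\bigcup_(W in F) closure W) y by exists W.
apply: cF => B yB; have [z [[W D'W Wz] [Bz Nz]]] := cy _ (filterI yB yN).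
exists z; split => //; exists W; last exact: subset_closure.
by split => //; exists z.
Qed.

Context (pY : paracompact Y).

(** Passage from separating points to separating a closed set; applied once it turns Hausdorff into
    regular, applied again regular into normal. *)
Lemma paracompact_separate A B : closed A ->
  (forall a, A a -> exists W, [/\ open W, W a & closure W `&` B = set0]) ->
  exists W, [/\ open W, A `<=` W & closure W `&` B = set0].
Proof.
move=> cA AB; case: pY => _.
(* The conclusion is conditional on meeting [A], so that the complement of [A] belongs to the family
   and completes the cover. *)
move=> /(_ [set W | open W /\ (W `&` A !=set0 -> closure W `&` B = set0)]) [].
  split; first by move=> W [].
  apply/seteqP; split => // y _; have [Ay|nAy] := pselect (A y).
    by have [W [oW Wy WB]] := AB y Ay; exists W.
  exists (~` A) => //; split; first exact: closed_openC.
  by case=> z [].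
move=> D [[oD covD] refD lfD]; pose D' := [set W | D W /\ W `&` A !=set0].
exists (\bigcup_(W in D') W); split.
- by apply: bigcup_open => W [/oD].
- move=> a Aa; have [W DW Wa] : (\bigcup_(W in D) W) a by rewrite covD.
  by exists W => //; split => //; exists a.
- rewrite -subset0 => y [].
  have D'D : D' `<=` D by move=> W [].
  move=> /(closure_locally_finite lfD D'D)[W [DW [a [Wa Aa]]] Wy] By.
  have [W' [_ W'B] WW'] := refD W DW.
  have <- : closure W' `&` B = set0 by apply: W'B; exists a; split => //;
    exact: WW'.
  by split => //; exact: closureS Wy.
Qed.

Lemma paracompact_regular A b : closed A -> ~ A b ->
  exists W, [/\ open W, A `<=` W & ~ closure W b].
Proof.
move=> cA nAb; have [hY _] := pY.
have [|W [oW AW Wb]] := @paracompact_separate A [set b] cA.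
  move=> a Aa; have ab : a != b by apply: contra_notN nAb => /eqP <-.
  move: hY; rewrite open_hausdorff => /(_ a b ab)[[W W']] /=.
  rewrite !inE => -[Wa W'b] [oW oW' WW'].
  exists W; split => //; rewrite -subset0 => _ [] /[swap] -> .
  move=> /(@closure_min _ (~` W')); apply => //; last exact: open_closedC.
  by move=> z Wz W'z; have : (W `&` W') z by []; rewrite WW'.
exists W; split => // Wb'.
by have : (closure W `&` [set b]) b by []; rewrite Wb.
Qed.

Lemma paracompact_normal (R : realType) : normal_space Y.
Proof.
apply/(@normal_openP R) => A B cA cB AB0.
have [|W [oW AW WB]] := @paracompact_separate A B cA.
  move=> a Aa.
  have nBa : ~ B a by move=> Ba; have : (A `&` B) a by []; rewrite AB0.
  have [W [oW BW nWa]] := paracompact_regular cB nBa.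
  exists (~` closure W); split => //; first exact/closed_openC/closed_closure.
  rewrite -subset0 => y [] /[swap] /BW Wy.
  move=> /(@closure_min _ (~` W)); apply => //; last exact: open_closedC.
  by apply: subsetC; exact: subset_closure.
exists W, (~` closure W); split => //.
- exact/closed_openC/closed_closure.
- by move=> b Bb Wb; have : (closure W `&` B) b by []; rewrite WB.
- by rewrite -subset0 => y [/subset_closure].
Qed.

(** Each member of a locally finite refinement is assigned to one index whose set contains it, and
    members with the same index are merged. *)
Lemma paracompact_refine (J : choiceType) (U : J -> set Y) :
  (forall j, open (U j)) -> \bigcup_j U j = setT ->
  exists W : J -> set Y, [/\ forall j, open (W j), forall j, W j `<=` U j,
    \bigcup_j W j = setT & forall y : Y, exists S : {fset J},
      \forall z \near y, forall j, W j z -> j \in S].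
Proof.
move=> oU covU; have [_ pc] := pY.
have /pc[D [[oD covD] refD lfD]] : open_cover (range U).
  split; first by move=> _ [j _ <-].
  by rewrite bigcup_image.
have : forall A, exists o : option J, D A -> exists2 j, o = Some j & A `<=` U j.
  move=> A; have [DA|nDA] := pselect (D A); last by exists None.
  by have [_ [j _ <-] AU] := refD A DA; exists (Some j) => _; exists j.
move=> /choice[idx idxP].
exists (fun j => \bigcup_(A in [set A | D A /\ idx A = Some j]) A); split.
- by move=> j; apply: bigcup_open => A [/oD].
- by move=> j y [A [DA Aj] Ay]; have [j'] := idxP A DA; rewrite Aj => -[<-];
  apply.
- apply/seteqP; split => // y _; have [A DA Ay] : (\bigcup_(A in D) A) y by
  rewrite covD.
  by have [j Aj _] := idxP A DA; exists j => //; exists A.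
- move=> y; have [N yN finN] := lfD y.
  have fin : finite_set (Some @^-1` (idx @` [set A | D A /\ A `&` N !=set0])).
    by apply: finite_preimage; [move=> a b _ _ []|exact: finite_image].
  exists (fset_set (Some @^-1` (idx @` [set A | D A /\ A `&` N !=set0]))).
  apply: filterS yN => z Nz j [A [DA Aj] Az].
  rewrite in_fset_set// inE; exists A => //; split => //.
  by exists z.
Qed.

(** By regularity the open sets whose closure lies in some [U j] form a cover. In a locally finite
    refinement of it, the closure of a union stays in [U j] when the closures of the members do. *)
Lemma paracompact_shrink (J : choiceType) (U : J -> set Y) :
  (forall j, open (U j)) -> \bigcup_j U j = setT ->
  exists F : J -> set Y, [/\ forall j, closed (F j),
    forall j, F j `<=` U j & \bigcup_j F j = setT].
Proof.
move=> oU covU; have [_ pc] := pY.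
have /pc[D [[oD covD] refD lfD]] :
    open_cover [set A | open A /\ exists j, closure A `<=` U j].
  split; first by move=> A [].
  apply/seteqP; split => // y _; have [j _ Ujy] : (\bigcup_j U j) y by rewrite
    covU.
  have [|W [oW UW Wy]] := @paracompact_regular (~` U j) y (open_closedC (oU j)).
    by apply.
  exists (~` closure W) => //; split; first exact/closed_openC/closed_closure.
  exists j => z; rewrite -[U j]setCK => + /UW Wz.
  move=> /(@closure_min _ (~` W)); apply => //; last exact: open_closedC.
  by apply: subsetC; exact: subset_closure.
pose D' j := [set A | D A /\ closure A `<=` U j].
exists (fun j => closure (\bigcup_(A in D' j) A)); split.
- by move=> j; exact: closed_closure.
- move=> j y; have D'D : D' j `<=` D by move=> A [].
  by move=> /(closure_locally_finite lfD D'D)[A [_]]; apply.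
- apply/seteqP; split => // y _; have [A DA Ay] : (\bigcup_(A in D) A) y by
  rewrite covD.
  have [W [_ [j Wj]] AW] := refD A DA; exists j => //.
  apply: subset_closure; exists A => //; split => //.
  by apply: subset_trans Wj; exact: closureS.
Qed.

(** Urysohn functions, equal to 1 on a closed shrinking and vanishing off a locally finite
    refinement; [normalize] turns them into a partition of unity. *)
Lemma paracompact_bumps (R : realType) (J : choiceType) (U : J -> set Y) :
  (forall j, open (U j)) -> \bigcup_j U j = setT ->
  exists b : Y -> J -> R, [/\ forall j, continuous (b ^~ j),
    forall y j, 0 <= b y j, forall y j, b y j != 0 -> U j y,
    forall y, exists j, b y j != 0 & forall y : Y, exists S : {fset J},
      \forall z \near y, forall j, b z j != 0 -> j \in S].
Proof.
move=> oU covU; have [W [oW WU covW lfW]] := paracompact_refine oU covU.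
have [F [cF FW covF]] := paracompact_shrink oW covW.
have : forall j, exists f : Y -> R, [/\ continuous f, range f `<=` `[0, 1],
    f @` (~` W j) `<=` [set 0] & f @` F j `<=` [set 1]].
  move=> j; apply/uniform_separatorP.
  apply: (iffLR (@normal_separatorP R Y) (paracompact_normal R)) => //.
    exact: open_closedC.
  by rewrite -subset0 => y [nWy /FW].
move=> /choice[f fP]; exists (fun y j => f j y).
have fW y j : f j y != 0 -> W j y.
  move=> fy; apply: contrapT => nWy; have [_ _ f0 _] := fP j.
  by move: fy; rewrite (f0 (f j y)) ?eqxx//; exists y.
split.
- by move=> j; have [] := fP j.
- move=> y j; have [_ f01 _ _] := fP j.
  have : `[0, 1]%classic (f j y) by apply: f01; exists y.
  by rewrite /= in_itv/= => /andP[].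
- by move=> y j /fW/WU.
- move=> y; have [j _ Fjy] : (\bigcup_j F j) y by rewrite covF.
  exists j; have [_ _ _ f1] := fP j.
  by rewrite (f1 (f j y)) ?oner_eq0//; exists y.
- move=> y; have [S yS] := lfW y; exists S.
  by apply: filterS yS => z zS j /fW/zS.
Qed.

End paracompact.

(** * Contractions of open sets *)

Section contraction.
Context {R : realType} {Y : topologicalType}.

Lemma nbhs_set_type (A : set Y) (x : set_type A) (N : set (set_type A)) :
  nbhs x N -> exists2 W : set Y, nbhs (val x) W & forall z : set_type A,
    W (val z) -> N z.
Proof.
rewrite [in X in X -> _]nbhsE => -[B [[W oW WB] Bx] BN]; exists W.
  by apply: open_nbhs_nbhs; split => //; rewrite -WB in Bx.
by move=> z Wz; apply: BN; rewrite -WB.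
Qed.

Lemma contraction_of_contractible (A : set Y) : open A ->
  contractible R (set_type A) ->
  exists k : Y -> R -> Y, [/\ forall y t, A y -> t <= 0 -> k y t = y,
    forall y z t, A y -> A z -> 1 <= t -> k y t = k z t,
    forall y t, A y -> A (k y t) &
    forall y t, A y -> {for (y, t), continuous (fun p : Y * R => k p.1 p.2)}].
Proof.
move=> oA [p [H [/continuous_clamp_within cH H0 H1]]].
(* Off [A] the value [y] is a mere default. Since [A] is open, it does not affect continuity at
   points of [A]. *)
pose k y t : Y :=
  if pselect (A y) is left h then val (H (SigSub (mem_set h), clamp t)) else y.
have kE y t (Ay : y \in A) : k y t = val (H (SigSub Ay, clamp t)).
  rewrite /k; case: pselect => [h|]; last by have /set_mem := Ay.
  by congr (val (H (_, _))); exact: val_inj.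
exists k; split.
- by move=> y t /mem_set Ay t0; rewrite kE clamp_le0// H0.
- by move=> y z t /mem_set Ay /mem_set Az t1; rewrite !kE clamp_ge1// !H1.
- by move=> y t /mem_set Ay; rewrite kE; apply: set_mem; exact: valP.
- move=> y t /mem_set Ay B; rewrite /= kE => nB.
  have cv : continuous (val : set_type A -> Y) by exact: initial_continuous.
  have [[N1 N2] /= [/nbhs_set_type[W yW WN] tN] NB] :=
    cH (SigSub Ay, t) _ (cv _ _ nB).
  exists (W `&` A, N2) => /=.
    by split => //; apply: filterI => //; apply: open_nbhs_nbhs; split => //;
      exact: set_mem.
  move=> [z u] /= [[Wz /mem_set Az] Nu]; rewrite kE.
  by apply: (NB (SigSub Az, u)); split => //; exact: WN.
Qed.

Lemma open_inter (V : choiceType) (U : V -> set Y) (s : {fset V}) :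
  (forall v, open (U v)) -> open (inter U s).
Proof.
move=> oU; rewrite openE => y sy; apply: (@near_fset _ (nbhs y) _) => v vs.
by apply: open_nbhs_nbhs; split => //; exact: sy.
Qed.

Lemma contractions (V : choiceType) (U : V -> set Y) :
  (forall v, open (U v)) ->
  (forall s, s != fset0 -> inter U s = set0 \/ contractible R (set_type (inter
    U s))) ->
  exists k : {fset V} -> Y -> R -> Y, [/\
    forall s y t, s != fset0 -> inter U s y -> t <= 0 -> k s y t = y,
    forall s y z t, s != fset0 -> inter U s y -> inter U s z -> 1 <= t ->
      k s y t = k s z t,
    forall s y t, s != fset0 -> inter U s y -> inter U s (k s y t) &
    forall s y t, s != fset0 -> inter U s y ->
      {for (y, t), continuous (fun p : Y * R => k s p.1 p.2)}].
Proof.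
move=> oU good.
have : forall s, exists k : Y -> R -> Y, s != fset0 -> [/\
    forall y t, inter U s y -> t <= 0 -> k y t = y,
    forall y z t, inter U s y -> inter U s z -> 1 <= t -> k y t = k z t,
    forall y t, inter U s y -> inter U s (k y t) &
    forall y t, inter U s y ->
      {for (y, t), continuous (fun p : Y * R => k p.1 p.2)}].
  move=> s; have [->|s0] := eqVneq s fset0; first by exists (fun y _ => y).
  have [s_empty|/(contraction_of_contractible (open_inter s oU))[k kP]] :=
    good s s0.
    by exists (fun y _ => y) => _; rewrite s_empty; split.
  by exists k.
move=> /choice[k kP]; exists k; split.
- by move=> s y t /kP[+ _ _ _]; apply.
- by move=> s y z t /kP[_ + _ _]; apply.
- by move=> s y t /kP[_ _ + _]; apply.
- by move=> s y t /kP[_ _ _ +]; apply.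
Qed.

End contraction.

(** * Levels of barycentric coordinates *)

Section levels.
Context {R : realType} {K : simplicial_complex}.
Local Notation N := (metric_realization R K).
Implicit Types (x y : N) (v w : K).

(** As a distance to the zero function, its continuity comes from the triangle inequality. *)
Definition sqnorm (x : N) : R := l2dist (val x) [fsfun] ^+ 2.

Lemma sqnormE x : sqnorm x = \sum_(v <- supp x) bary x v ^+ 2.
Proof.
rewrite /sqnorm (@l2dist_widen _ _ _ _ (supp x)); last first.
  by rewrite finsupp0 fsetU0 fsubset_refl.
rewrite sqr_sqrtr; last by apply: sumr_ge0 => v _; exact: sqr_ge0.
by apply: eq_bigr => v _; rewrite fsfun0E subr0.
Qed.

Lemma continuous_sqnorm : continuous sqnorm.
Proof.
move=> x; have : {for x, continuous (fun y : N => l2dist (val y) [fsfun] : R)}.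
  apply/cvgrPdist_lt => e e0; apply/nbhs_realizationP; exists e => // y.
  apply: le_lt_trans; rewrite ler_distl; apply/andP; split.
    rewrite lerBlDr addrC [l2dist (val x) (val y)]l2dist_sym addrC.
    by rewrite addrC; exact: (l2dist_triangle (val x)).
  by rewrite addrC; exact: (l2dist_triangle (val y)).
by move=> c; apply: cvgM.
Qed.

(** The squared norm is the average of the coordinates weighted by themselves, so it cannot exceed
    all of them. *)
Lemma exists_bary_ge_sqnorm x : exists2 v, v \in supp x & sqnorm x <= bary x v.
Proof.
apply: contrapT => /forall2NP nx.
have : sqnorm x < sqnorm x.
  rewrite {1}sqnormE -[ltRHS]mulr1 -(sum_bary x) mulr_sumr.
  have /fset0Pn[v vx] := simplex_neq0 (supp_simplex x).
  have lt w : w \in supp x -> bary x w ^+ 2 < sqnorm x * bary x w.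
    move=> wx; rewrite expr2 ltr_pM2r ?bary_gt0//.
    by have [//|/negP] := nx w; rewrite -ltNge.
  rewrite (big_fsetD1 v)//= [ltRHS](big_fsetD1 v)//= ltr_leD ?lt//.
  rewrite big_seq [leRHS]big_seq; apply: ler_sum => w.
  by rewrite !inE => /andP[_ /lt/ltW].
by rewrite ltxx.
Qed.

Lemma sqnorm_gt0 x : 0 < sqnorm x.
Proof.
have [v vx _] := exists_bary_ge_sqnorm x.
rewrite sqnormE (big_fsetD1 v)//= ltr_pwDl ?exprn_gt0 ?bary_gt0//.
by apply: sumr_ge0 => w _; exact: sqr_ge0.
Qed.

(** A metric neighbourhood may meet infinitely many simplices, but a coordinate of [y] outside
    [supp x] is at most the distance to [x], hence below a quarter of [sqnorm x], which is less than
    half of [sqnorm y]. *)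
Lemma near_bary_lt_sqnorm x :
  \forall y \near x, forall v, sqnorm y / 2 < bary y v -> v \in supp x.
Proof.
have s0 := sqnorm_gt0 x.
have near1 : \forall y \near x, sqnorm x / 2 < sqnorm y.
  by apply: (@cvgr_gt R _ (nbhs x) _ sqnorm _ (@continuous_sqnorm x)); lra.
have near2 : \forall y \near x, l2dist (val x) (val y) < sqnorm x / 4.
  by apply/nbhs_realizationP; exists (sqnorm x / 4) => //; lra.
apply: (@filterS2 _ (nbhs x) _ _ _ _ _ near1 near2) => y y1 y2 v.
apply: contraTT; rewrite in_supp negbK -leNgt => /eqP xv.
have := le_lt_trans (ler_bary_dist x y v) y2.
by rewrite xv sub0r normrN ger0_norm ?bary_ge0//; lra.
Qed.

(* Truncated coordinates, normalized so that the top level is at least the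
   number of vertices at positive level. *)
Definition level (x : N) (v : K) : R :=
  Num.min (Num.max 0 (bary x v - sqnorm x / 2)) (sqnorm x / 4) *
  (8 / sqnorm x ^+ 2).

Let scale_gt0 x : 0 < 8 / sqnorm x ^+ 2.
Proof. by rewrite divr_gt0// exprn_gt0// sqnorm_gt0. Qed.

Lemma level_ge0 x v : 0 <= level x v.
Proof.
apply: mulr_ge0; last exact: ltW.
by rewrite le_min le_max lexx/=; have := sqnorm_gt0 x; lra.
Qed.

Lemma level_gt0 x v : 0 < level x v -> sqnorm x / 2 < bary x v.
Proof.
by rewrite pmulr_lgt0// lt_min lt_max ltxx/= subr_gt0 => /andP[].
Qed.

Lemma level_gt0_supp x v : 0 < level x v -> v \in supp x.
Proof.
move=> /level_gt0; rewrite -bary_gt0; apply: le_lt_trans.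
by rewrite divr_ge0// ltW// sqnorm_gt0.
Qed.

Lemma level_le x v : level x v <= 2 / sqnorm x.
Proof.
have s0 := sqnorm_gt0 x.
have -> : 2 / sqnorm x = sqnorm x / 4 * (8 / sqnorm x ^+ 2).
  by field; rewrite gt_eqF.
by rewrite ler_pM2r// ge_min lexx orbT.
Qed.

Lemma level_top x v : 3 / 4 * sqnorm x <= bary x v -> level x v = 2 / sqnorm x.
Proof.
have s0 := sqnorm_gt0 x => xv.
rewrite /level (min_idPr _); first by field; rewrite gt_eqF.
by rewrite le_max; apply/orP; right; lra.
Qed.

(** Each such vertex carries more than [sqnorm x / 2] of a total mass 1. The bound equals the
    saturated level of [level_top], which accounts for the factor [8 / sqnorm x ^+ 2]. *)
Lemma card_level_gt0 x (S : {fset K}) :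
  (#|` [fset v in S | 0 < level x v]%fset|)%:R <= 2 / sqnorm x.
Proof.
have s0 := sqnorm_gt0 x; set T := [fset _ | _ in _ & _]%fset.
have -> : 2 / sqnorm x = (sqnorm x / 2)^-1 by rewrite invf_div.
rewrite -[leRHS]mul1r ler_pdivlMr ?divr_gt0//.
apply: le_trans (sum_bary_le1 x T).
have -> : #|` T|%:R * (sqnorm x / 2) = \sum_(v <- T) sqnorm x / 2.
  by rewrite big_const_seq count_predT iter_addr_0 mulr_natl.
rewrite big_seq [leRHS]big_seq; apply: ler_sum => v.
by rewrite !inE => /andP[_ /level_gt0/ltW].
Qed.

Lemma continuous_level v : continuous (level ^~ v).
Proof.
move=> x; have cs := @continuous_sqnorm x.
have cb := @continuous_bary _ _ v x.
apply: cvgM; last first.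
  apply: cvgMl_tmp; apply: cvgV; first by rewrite gt_eqF// exprn_gt0//
    sqnorm_gt0.
  by rewrite expr2; apply: cvgM.
apply: cvg_minr; last by apply: cvgMr_tmp.
apply: cvg_maxr; first exact: cvg_cst.
by apply: cvgB => //; apply: cvgMr_tmp.
Qed.

(** This map mediates between the identity and [f \o g]: it keeps [x] in its closed simplex and
    retains only vertices above the upper threshold, those [v] for which [g x] lies in [U v]. *)
Lemma collapse_ex : exists a : N -> N, [/\ continuous a, locally_finite_map a &
  forall x v, (v \in supp (a x)) = (3 / 4 * sqnorm x < bary x v)].
Proof.
have bE x v : (Num.max 0 (bary x v - 3 / 4 * sqnorm x) != 0) =
    (3 / 4 * sqnorm x < bary x v).
  have [h|h] := ltP (3 / 4 * sqnorm x) (bary x v).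
    by rewrite gt_eqF// lt_max subr_gt0 h orbT.
  by rewrite (max_idPl _) ?eqxx// subr_le0.
have bx x v : 3 / 4 * sqnorm x < bary x v -> v \in supp x.
  rewrite -bary_gt0; apply: le_lt_trans.
  by rewrite mulr_ge0// ltW// sqnorm_gt0.
have [|||||a [ca fa aE]] := @normalize R K N
  (fun x v => Num.max 0 (bary x v - 3 / 4 * sqnorm x)).
- move=> v x; apply: cvg_maxr; first exact: cvg_cst.
  by apply: cvgB; [exact: continuous_bary|apply: cvgMl_tmp;
    exact: continuous_sqnorm].
- by move=> x v; rewrite le_max lexx.
- move=> x; exists (supp x); have := near_bary_lt_sqnorm x.
  apply: filterS => y yx v; rewrite bE => yv; apply: yx.
  by have := sqnorm_gt0 y; lra.
- move=> x; have [v _ xv] := exists_bary_ge_sqnorm x; exists v.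
  by rewrite bE; have := sqnorm_gt0 x; lra.
- move=> x s s0 sx; apply: (simplex_sub (supp_simplex x)) => //.
  by apply/fsubsetP => v /sx; rewrite bE => /bx.
by exists a; split => // x v; rewrite aE bE.
Qed.

End levels.

(** * The nerve equivalence *)

Section nerve_equivalence.
Context {R : realType} {K : simplicial_complex} {Y : topologicalType}.
Context (U : K -> set Y).
Local Notation N := (metric_realization R K).
Local Notation Nw := (weak_realization R K).
Context (oU : forall v, open (U v)).
Context (simplexP : forall s : {fset K},
  simplex s <-> s != fset0 /\ inter U s !=set0).
Context (good : forall s : {fset K}, s != fset0 ->
  inter U s = set0 \/ contractible R (set_type (inter U s))).

Lemma exists_flow : exists g : N -> Y, [/\ continuous g,
  forall x v, 3 / 4 * sqnorm x < bary x v -> U v (g x) &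
  forall f : Y -> N, continuous f ->
    (forall y v, v \in supp (f y) -> U v y) -> homotopic R idfun (g \o f)].
Proof.
have [k [k0 k1 kU kc]] := contractions oU good.
have : forall x : N, exists y, inter U (supp x) y.
  by move=> x; have /simplexP[] := supp_simplex x.
move=> /choice[pt ptP].
pose g x := sflow k (supp x) (level x) (pt x).
(* A vertex with largest coordinate reaches level [2 / sqnorm x], at least the number of vertices at
   positive level, so some contraction runs to its end. *)
have forget x s t y z : (forall v, 0 < level x v -> (v \in s) && (v \in t)) ->
    inter U s y -> inter U t z -> sflow k s (level x) y = sflow k t (level x) z.
  move=> st; have [w _ xw] := exists_bary_ge_sqnorm x.
  have s0 := sqnorm_gt0 x.
  have lw : level x w = 2 / sqnorm x by apply: level_top; lra.
  apply: (@sflow_forget R K Y U k k0 k1 kU _ _ _ _ _ w) => //.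
  - exact: level_ge0.
  - by rewrite lw divr_gt0.
  - by rewrite lw; exact: card_level_gt0.
exists g; split.
(* The chosen [pt] has no continuity; near [x0] both it and the support are frozen at [x0], which
   [forget] allows. *)
- move=> x0; apply: (@continuous_near_eq _ _
    (fun x => sflow k (supp x0) (level x) (pt x0))).
    apply: (@continuous_sflow R K Y U k k0 kU kc N x0) => //.
    + by move=> *; exact: level_ge0.
    + by move=> v; exact: continuous_level.
    + exact: cst_continuous.
  have := near_bary_lt_sqnorm x0; apply: filterS => x x0x.
  apply: forget => // v lv; rewrite (level_gt0_supp lv) andbT.
  by apply: x0x; exact: level_gt0.
- move=> x v xv; have s0 := sqnorm_gt0 x.
  apply: (@sflow_in R K Y U k k0 kU) => //.
    by rewrite -bary_gt0; apply: lt_trans xv; lra.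
  by move=> w _; rewrite (level_top (ltW xv)); exact: level_le.
- move=> f cf fU.
  pose H (p : Y * R) := sflow k (supp (f p.1)) (fun v =>
    clamp p.2 * level (f p.1) v) p.1.
  have lvl0 (p : Y * R) v : 0 <= clamp p.2 * level (f p.1) v.
    by rewrite mulr_ge0 ?clamp_ge0 ?level_ge0.
  have lvlS (p : Y * R) v : 0 < clamp p.2 * level (f p.1) v ->
    0 < level (f p.1) v.
    move=> h; rewrite lt_neqAle level_ge0 andbT.
    by apply: contraTneq h => <-; rewrite mulr0 ltxx.
  apply: (@homotopicI _ _ _ _ _ H).
  (* Here nothing is forgotten for small times, so only the vertex set is frozen; the start [y] must
     therefore stay in the intersection over [supp (f y0)], which is open. *)
  + move=> [y0 t0]; apply: (@continuous_near_eq _ _ (fun p : Y * R =>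
      sflow k (supp (f y0)) (fun v => clamp p.2 * level (f p.1) v) p.1)).
      apply: (@continuous_sflow R K Y U k k0 kU kc (Y * R)%type (y0, t0)) => //.
      * move=> v; apply: cvgM; first by apply: cvg_clamp; exact: cvg_snd.
        have cl : continuous (fun y => level (f y) v : R).
          move=> y; apply: (@continuous_comp Y N R f (level ^~ v));
            first exact: cf.
          exact: continuous_level.
        exact: (@continuous_fst_comp Y R R _ cl).
      * exact: cvg_fst.
      * by move=> v /fU.
    have near1 : \forall y \near y0, forall v,
      sqnorm (f y) / 2 < bary (f y) v ->
        v \in supp (f y0).
      exact: (cf y0 _ (near_bary_lt_sqnorm (f y0))).
    have near2 : \forall y \near y0, inter U (supp (f y0)) y.
      by apply: open_nbhs_nbhs; split; [exact: open_inter|exact: fU].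
    exists ([set y | (forall v, sqnorm (f y) / 2 < bary (f y) v ->
        v \in supp (f y0)) /\ inter U (supp (f y0)) y], setT).
      by split; [exact: filterI near1 near2|exact: filterT].
    move=> [y t] /= [[y1 y2] _]; rewrite /H/=.
    apply: (@sflow_eq_mem R K Y U k k0 kU) => //.
    * by move=> v; exact: (lvl0 (y, t)).
    * exact: fU.
    * move=> v /(lvlS (y, t)) lv; rewrite (level_gt0_supp lv).
      by apply: y1; exact: level_gt0.
  + move=> y; apply: (@sflow0 R K Y U k k0) => //= [v|]; last exact: fU.
    by rewrite clamp_le0// mul0r.
  + move=> y; rewrite /H/= /g/=; under eq_fun do rewrite clamp_ge1// mul1r.
    by apply: forget => [v /level_gt0_supp ->//||//]; exact: fU.
Qed.

Lemma simplexU (s t : {fset K}) y : s != fset0 -> inter U s y -> inter U t y ->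
  simplex (s `|` t)%fset.
Proof.
move=> /fset0Pn[v vs] sy ty; apply/simplexP; split.
  by apply/fset0Pn; exists v; rewrite inE vs.
by exists y => w; rewrite inE => /orP[/sy|/ty].
Qed.

Lemma supp_neq0 (x : N) : supp x != fset0.
Proof. exact: simplex_neq0 (supp_simplex x). Qed.

Lemma locally_finite_comp (Z Z' : topologicalType) (a : Z -> N) (c : Z' -> Z) :
  locally_finite_map a -> continuous c -> locally_finite_map (a \o c).
Proof. by move=> fa cc z; have [S aS] := fa (c z); exists S;
  exact: (cc z _ aS). Qed.

(** Both [f \o g] and the identity are homotopic to the collapse [a] along segments. In the weak
    topology the first homotopy is continuous by local finiteness, the second because it preserves
    every closed simplex. *)
Lemma nerve_equivalence (f : Y -> N) : continuous f -> locally_finite_map f ->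
  (forall y v, v \in supp (f y) -> U v y) ->
  homotopy_equivalence R f /\ homotopy_equivalence R (f : Y -> Nw).
Proof.
move=> cf ff fU; have [g [cg gU gf]] := exists_flow.
have [a [ca fa aE]] := @collapse_ex R K.
have sub x : (supp (a x) `<=` supp x)%fset.
  apply/fsubsetP => v; rewrite aE -bary_gt0; apply: le_lt_trans.
  by rewrite mulr_ge0// ltW// sqnorm_gt0.
have sa x : simplex (supp x `|` supp (a x))%fset.
  by rewrite (fsetUidPl _ _ (sub x)); exact: supp_simplex.
(* The point [g x] is a common witness: it lies in [U v] for every vertex of [f (g x)] and of
   [a x]. *)
have sfg x : simplex (supp (f (g x)) `|` supp (a x))%fset.
  apply: (@simplexU _ _ (g x)); first exact: supp_neq0.
    by move=> v /fU.
  by move=> v; rewrite aE => /gU.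
have cfg : continuous (f \o g).
  by move=> x; exact: (@continuous_comp _ _ _ g f x (cg x) (cf _)).
split.
  split => //; exists g; split => //; first exact/homotopic_sym/gf.
  apply: (@homotopic_trans R N N a).
    exact: (segment_homotopic cfg ca sfg).
  apply/homotopic_sym; apply: segment_homotopic => // x.
  exact: cvg_id.
have cw := @continuous_weak_metric R K.
split; first exact: continuous_weak.
exists (g \o (idfun : Nw -> N)); split.
- by move=> x; exact: (@continuous_comp Nw N Y idfun g x (cw x) (cg x)).
- exact/homotopic_sym/gf.
- apply: (@homotopic_trans R Nw Nw (a \o (idfun : Nw -> N))).
    apply: (@segment_homotopic_weak R K Nw ((f \o g) \o (idfun : Nw ->
      N)) (a \o (idfun : Nw -> N))) => //.
    + by move=> x; exact: (@continuous_comp Nw N N idfun (f \o g) x (cw x)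
      (cfg x)).
    + by move=> x; exact: (@continuous_comp Nw N N idfun a x (cw x) (ca x)).
    + apply: (@locally_finite_comp Y Nw f (g \o idfun) ff) => x.
      exact: (@continuous_comp Nw N Y idfun g x (cw x) (cg x)).
    + exact: locally_finite_comp.
  have [|H [cH H0 H1 Hs]] := segment_homotopy _ ca sa; first by move=> x;
    exact: cvg_id.
  apply/homotopic_sym; apply: (@homotopicI R Nw Nw _ _ (H : Nw * R -> Nw)) =>
    //.
  apply: continuous_simplexwise => // s sK; exists s => // x t xs.
  apply: fsubset_trans (Hs x t) _; rewrite fsubUset xs/=.
  exact: fsubset_trans (sub x) xs.
Qed.

End nerve_equivalence.

(** * Simplicial actions *)

Section realize_automorphism.
Context {R : realType} {K : simplicial_complex}.
Local Notation N := (metric_realization R K).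
Local Notation Nw := (weak_realization R K).
Context (phi psi : simplicial_map K K).
Context (phiK : cancel phi psi) (psiK : cancel psi phi).

(** Since [phi] is injective, the sum defining [push] has at most one term. *)
Lemma bary_realize (x : N) v : bary (realize phi x) v = bary x (psi v).
Proof.
rewrite /bary/= /push fsfunE.
have sumE : \sum_(w <- supp x | phi w == v) bary x w = bary x (psi v).
  rewrite (eq_bigl (fun w => w == psi v)); last first.
    by move=> w; rewrite -(can_eq psiK) phiK.
  rewrite -big_filter; have [vx|vx] := boolP (psi v \in supp x).
    by rewrite filter_pred1_uniq// big_seq1.
  rewrite big1_seq => [|w /andP[_]]; last first.
    by rewrite mem_filter => /andP[/eqP -> vx']; rewrite vx' in vx.
  by move: vx; rewrite in_supp negbK => /eqP.
case: ifPn => // vx; rewrite -[LHS]/(0 : R); symmetry; apply/eqP.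
rewrite -[_ == 0]negbK -in_supp; apply: contra vx => vx.
by apply/imfsetP; exists (psi v) => //; rewrite psiK.
Qed.

Lemma supp_realize (x : N) v : (v \in supp (realize phi x)) = (psi v \in supp
  x).
Proof. by rewrite !in_supp bary_realize. Qed.

Lemma continuous_realize : continuous (realize phi : N -> N).
Proof.
move=> x; apply: continuous_realization => v.
apply: (@continuous_eq1 _ _ (fun y => bary y (psi v)));
  first exact: continuous_bary.
by move=> y; rewrite bary_realize.
Qed.

Lemma continuous_realize_weak : continuous (realize phi : Nw -> Nw).
Proof.
(* A homotopy constant in time reduces the claim to [continuous_simplexwise]. *)
have c : continuous ((fun p => realize phi p.1) : Nw * R -> Nw).
  apply: (@continuous_simplexwise R K (fun p : N * R => realize phi p.1)).
    exact: (@continuous_fst_comp N R N _ continuous_realize).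
  move=> s sK; exists [fset phi v | v in s]%fset; first exact: smapP.
  move=> x t /fsubsetP xs; apply/fsubsetP => v; rewrite supp_realize => /xs vs.
  by apply/imfsetP; exists (psi v) => //; rewrite psiK.
move=> x; apply: (@continuous_comp Nw (Nw * R)%type Nw (fun x => (x, 0 : R))
  (fun p => realize phi p.1)); last exact: c.
by apply: continuous_pair; [exact: cvg_id|exact: cvg_cst].
Qed.

Lemma locally_finite_realize (Z : topologicalType) (a : Z -> N) :
  locally_finite_map a -> locally_finite_map (realize phi \o a).
Proof.
move=> fa z; have [S aS] := fa z; exists [fset phi v | v in S]%fset.
apply: filterS aS => y /fsubsetP yS; apply/fsubsetP => v /=.
rewrite supp_realize => /yS vS.
by apply/imfsetP; exists (psi v) => //; rewrite psiK.
Qed.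

End realize_automorphism.

Lemma homeo_actionI (G : groupType) (T : topologicalType) (act : G -> T -> T) :
  is_action act -> (forall g, continuous (act g)) -> is_homeo_action act.
Proof.
move=> [act1 actM] cact; split => // g; split => //; exists (act g^-1%g).
split => // x; first by rewrite -actM mulVg act1.
by rewrite -actM mulgV act1.
Qed.

Lemma simplicial_action_realize (R : realType) (G : groupType)
    (K : simplicial_complex) (rho : G -> simplicial_map K K) :
  is_action (fun g v => rho g v) ->
  is_homeo_action (fun g => realize (rho g) :
    metric_realization R K -> metric_realization R K) /\
  is_homeo_action (fun g => realize (rho g) :
    weak_realization R K -> weak_realization R K).
Proof.
move=> [rho1 rhoM].
have rhoK g : cancel (rho g) (rho g^-1%g) by move=> v; rewrite -rhoM mulVg rho1.
have rhoVK g : cancel (rho g^-1%g) (rho g) by move=> v;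
  rewrite -rhoM mulgV rho1.
have barE g (x : metric_realization R K) v :=
  bary_realize (rhoK g) (rhoVK g) x v.
have act : is_action (fun g => realize (rho g) :
    metric_realization R K -> metric_realization R K).
  split => [x|g h x]; apply: realization_eq => v; rewrite !barE.
    by rewrite invg1 rho1.
  by rewrite invgM rhoM.
split; apply: homeo_actionI => // g.
  exact: continuous_realize (rhoK g) (rhoVK g).
exact: continuous_realize_weak (rhoK g) (rhoVK g).
Qed.

Lemma simplicial_action_automorphism (G : groupType) (K : simplicial_complex)
    (rho : G -> simplicial_map K K) g :
  is_action (fun g v => rho g v) -> simplicial_automorphism (rho g).
Proof.
move=> [rho1 rhoM]; exists (rho g^-1%g).
by split => v; rewrite -rhoM ?mulVg ?mulgV rho1.
Qed.

Theorem theorem2p7 (R : realType) (G : groupType) (Y : topologicalType)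
  (I : choiceType) (actY : G -> Y -> Y) (actI : G -> I -> I) (U : I -> set Y)
  (Y_paracompact : paracompact Y)
  (actY_homeo : is_homeo_action actY)
  (actI_action : is_action actI)
  (U_open : forall i, open (U i))
  (U_cover : \bigcup_i U i = setT)
  (U_equivariant : forall g i, actY g @` U i = U (actI g i))
  (U_good : forall F : {fset I}, F != fset0 ->
     \bigcap_(i in [set` F]) U i = set0 \/
     contractible R (set_type (\bigcap_(i in [set` F]) U i))) :
  exists rho : G -> simplicial_map (nerve U) (nerve U),
    [/\ forall g (v : nerve U), val (rho g v) = actI g (val v),
        is_action (fun g (v : nerve U) => rho g v),
        forall g, simplicial_automorphism (rho g),
        exists f : Y -> metric_realization R (nerve U),
          Gsim_homotopy_equivalence R actY (fun g => realize (rho g)) f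
      & exists f : Y -> weak_realization R (nerve U),
          Gsim_homotopy_equivalence R actY
            (fun g => realize (rho g) :
               weak_realization R (nerve U) -> weak_realization R (nerve U))
            f].
Proof.
(* The cover is reindexed by its nonempty members, which are the vertices of the nerve. *)
pose W (v : nerve U) : set Y := U (val v).
have U_act g i y : U (actI g i) (actY g y) <-> U i y.
  have [[actY1 actYM] _] := actY_homeo.
  rewrite -U_equivariant; split => [[z Uz zy]|Uy]; last by exists y.
  by rewrite -(actY1 y) -(mulVg g) actYM -zy -actYM mulVg actY1.
have vertex_act g (v : nerve U) : [set i | U i !=set0] (actI g (val v)).
  by have [y Uy] := set_valP v; exists (actY g y); apply/U_act.
pose r g (v : nerve U) : nerve U := SigSub (mem_set (vertex_act g v)).
have r_simplex g (s : {fset nerve U}) :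
    simplex s -> simplex [fset r g v | v in s]%fset.
  move=> [/fset0Pn[v vs] [y sy]]; split.
    by apply/fset0Pn; exists (r g v); apply/imfsetP; exists v.
  exists (actY g y) => _ /= /imfsetP[w /= ws ->]; apply/U_act; exact: sy.
pose rho g := SimplicialMap (r_simplex g).
have rho_action : is_action (fun g (v : nerve U) => rho g v).
  have [actI1 actIM] := actI_action.
  by split => [v|g h v]; apply: val_inj; rewrite /= ?actI1 ?actIM.
have [rho1 rhoM] := rho_action.
have rhoK g : cancel (rho g) (rho g^-1%g) by move=> v; rewrite -rhoM mulVg rho1.
have rhoVK g : cancel (rho g^-1%g) (rho g) by move=> v;
  rewrite -rhoM mulgV rho1.
have simplexP (s : {fset nerve U}) : simplex s <->
  s != fset0 /\ inter W s !=set0.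
  by [].
have W_open v : open (W v) by exact: U_open.
have W_cover : \bigcup_v W v = setT.
  apply/seteqP; split => // y _; have [i _ Uy] : (\bigcup_i U i) y by rewrite
    U_cover.
  have Ui : [set i | U i !=set0] i by exists y.
  by exists (SigSub (mem_set Ui)).
have W_good (s : {fset nerve U}) : s != fset0 ->
    inter W s = set0 \/ contractible R (set_type (inter W s)).
  move=> /fset0Pn[v vs].
  have -> : inter W s = \bigcap_(i in [set` [fset val v | v in s]%fset]) U i.
    apply/seteqP; split => y sy.
      by move=> _ /imfsetP[w /= ws ->]; exact: sy.
    by move=> w ws; apply: sy; apply/imfsetP; exists w.
  by apply: U_good; apply/fset0Pn; exists (val v); apply/imfsetP; exists v.
have [b [cb b0 bW bn0 bfin]] := paracompact_bumps Y_paracompact R W_open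
  W_cover.
have [|f [cf ff fE]] := normalize cb b0 bfin bn0.
  move=> y s s0 sb; apply/simplexP; split => //.
  by exists y => v /sb/bW.
have fW y v : v \in supp (f y) -> W v y by rewrite fE; exact: bW.
have [eqm eqw] := nerve_equivalence W_open simplexP W_good cf ff fW.
have [act_m act_w] := simplicial_action_realize R rho_action.
have c_act g : continuous (actY g) by have [_ /(_ g)[]] := actY_homeo.
have c_fa g : continuous (f \o actY g).
  by move=> y; exact: (@continuous_comp _ _ _ (actY g) f y (c_act g y) (cf _)).
have c_af g : continuous ((realize (rho g) : metric_realization R (nerve U) ->
  _) \o f).
  move=> y; apply: (@continuous_comp _ _ _ f (realize (rho g)) y (cf y)).
  exact: (continuous_realize (rhoK g) (rhoVK g)).
(* The common witness is [actY g y]: a vertex [v] of the translate of [f y] comes from a vertex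
   [rho g^-1 v] of [f y], whose open set contains [y]. *)
have seg g y : simplex (supp (realize (rho g) (f y)) `|` supp (f (actY g
  y)))%fset.
  apply: (simplexU simplexP (supp_neq0 _) (y := actY g y));
    last by move=> v /fW.
  move=> v; rewrite (supp_realize (rhoK g) (rhoVK g)) => /fW Wy.
  by rewrite -(rhoVK g v); exact/U_act.
exists rho; split => //.
- by move=> g; exact: simplicial_action_automorphism.
- exists f; split => // g.
  exact: (segment_homotopic (c_af g) (c_fa g) (seg g)).
- exists f; split => // g.
  apply: (segment_homotopic_weak (c_af g) (c_fa g) _ _ (seg g)).
    exact: (locally_finite_realize (rhoK g) (rhoVK g)).
  exact: locally_finite_comp.
Qed.
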